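(* Let $\eta,\beta,\epsilon,\alpha_c$ be real numbers and $r_c$ a positive integer. Assume one of the following: (a) $\beta=0.20$, $\epsilon=0.50$, $r_c=1$, $\eta=\beta\epsilon^{r_c}$, and $\alpha_c=1$; or (b) $\beta=0.25$, $\epsilon=0.70$, $r_c=2$, $\eta=\beta\epsilon^{r_c}$, and $\alpha_c=1$. If $z\in\mathcal{N}(\beta)$, then the corrector phase (that is, $r_c$ consecutive corrector steps with step length $\alpha_c$, starting from $z$) yields a point $z^+$ that satisfies $z^+\in\mathcal{N}(\eta)$.
   Context: Setting. $\langle\cdot,\cdot\rangle$ is the standard inner product and $\|\cdot\|$ the Euclidean norm. $K\subset\mathbb{R}^n$ is a proper cone (closed, convex, pointed, full-dimensional), $K^*=\{s\in\mathbb{R}^n:\langle x,s\rangle\ge 0\ \forall x\in K\}$ its dual cone, and $C^\circ$ denotes the interior of a set $C$. $A$ is an $m\times n$ real matrix of full row rank, $b\in\mathbb{R}^m$, $c\in\mathbb{R}^n$. Self-concordance and barriers. Let $F:K^\circ\to\mathbb{R}$ be twice continuously differentiable with gradient $g(x)$ and positive definite Hessian $H(x)$ for all $x\in K^\circ$. Put $\|u\|_x:=\|H(x)^{1/2}u\|$, $\|u\|_x^*:=\|H(x)^{-1/2}u\|$, $B_x(u,r):=\{v\in\mathbb{R}^n:\|v-u\|_x<r\}$. $F$ is self-concordant if for all $x\in K^\circ$ one has $B_x(x,1)\subset K^\circ$, and for all $u\in B_x(x,1)$ and $v\ne0$, $1-\|u-x\|_x\le\|v\|_u/\|v\|_x\le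 1/(1-\|u-x\|_x)$. A self-concordant $F$ is a logarithmically homogeneous barrier with parameter $\nu$ if $\nu:=\sup_{x\in K^\circ}(\|g(x)\|_x^* )^2<\infty$ and $F(tx)=F(x)-\nu\ln t$ for all $x\in K^\circ$, $t>0$. Fix such an $F$ with parameter $\nu$. Extended objects. $\bar x:=(x;\tau)$, $\bar s:=(s;\kappa)$, $z:=(\bar x;y;\bar s)$, $\bar K:=K\times\mathbb{R}_+$, $\bar K^*:=K^*\times\mathbb{R}_+$, $\mathcal{F}:=\bar K\times\mathbb{R}^m\times\bar K^*$. $\bar F(\bar x):=F(x)-\log\tau$ on $\bar K^\circ$ has gradient $\bar g(\bar x)$ and Hessian $\bar H(\bar x)$; it is a logarithmically homogeneous barrier with parameter $\bar\nu:=\nu+1$ (and $\bar\nu\ge2$). For $\bar x\in\bar K^\circ$, $\|u\|_{\bar x}:=\|\bar H(\bar x)^{1/2}u\|$ and $\|u\|_{\bar x}^*:=\|\bar H(\bar x)^{-1/2}u\|$. $G:=\begin{pmatrix}0&A&-b\\ -A^\top&0&c\\ b^\top&-c^\top&0\end{pmatrix}$. $\mu(z):=\bar x^\top\bar s/\bar\nu$. $\psi(\bar x,\bar s,t):=\bar s+t\,\bar g(\bar x)$, and $\psi(z):=\psi(\bar x,\bar s,\mu(z))$. For $\theta\in[0,1]$, $\mathcal{N}(\theta):=\{z=(\bar x;y;\bar s)\in\mathcal{F}^\circ:\|\psi(z)\|_{\bar x}^*\le\theta\mu(z)\}$. Corrector system at $z=(\bar x;y;\bar s)\in\mathcal{F}^\circ$,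 with unknowns $\Delta_z=(\Delta_{\bar x};\Delta_y;\Delta_{\bar s})\in\mathbb{R}^{n+1}\times\mathbb{R}^m\times\mathbb{R}^{n+1}$: $G(\Delta_y;\Delta_{\bar x})-(0;\Delta_{\bar s})=0$ and $\Delta_{\bar s}+\mu(z)\bar H(\bar x)\Delta_{\bar x}=-\psi(z)$. A corrector step with step length $\alpha_c$ replaces the current $z$ by $z+\alpha_c\Delta_z$, where $\Delta_z$ is the solution of the corrector system at the current $z$; the corrector phase performs $r_c$ such steps in succession. *)

(* Defs.v *)
(* Vectors of R^n are columns 'cV[R]_n. The library norm on
   matrices is the sup norm: it is used here only through the topology it
   induces, and the Euclidean norm is [enorm]. *)
From HB Require Import structures.
From mathcomp Require Import all_boot all_order all_algebra.
From mathcomp Require Import all_classical all_reals all_analysis.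

Set Implicit Arguments.
Unset Strict Implicit.
Unset Printing Implicit Defensive.

Import Order.TTheory GRing.Theory Num.Theory.
Import numFieldNormedType.Exports.

Local Open Scope classical_set_scope.
Local Open Scope ring_scope.

Section Euclidean.
Context {R : realType} {n : nat}.
Implicit Types (u v : 'cV[R]_n) (M S : 'M[R]_n).

Definition inner u v : R := (u^T *m v) 0 0.

Definition enorm u : R := Num.sqrt (inner u u).

Definition psdmx M : Prop := M^T = M /\ forall u, 0 <= inner u (M *m u).

Definition pdmx M : Prop :=
  M^T = M /\ forall u, u != 0 -> 0 < inner u (M *m u).

(* M^{1/2}, the positive semidefinite square root, unique when it exists, that
   is, when M is positive semidefinite; the value is 0 otherwise. *)
Definition sqrtmx M : 'M[R]_n := xget 0 [set S | psdmx S /\ S *m S = M].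

End Euclidean.

Section Cones.
Context {R : realType} {n : nat}.
Implicit Types K : set 'cV[R]_n.

Definition proper_cone K : Prop :=
  [/\ (forall t x, 0 <= t -> K x -> K (t *: x)),
      closed K,
      convex_set K,
      (forall x, K x -> K (- x) -> x = 0) &
      K° !=set0].

Definition dual_cone K : set 'cV[R]_n :=
  [set s | forall x, K x -> 0 <= inner x s].

(* K x R_+; the vector (x; tau) of R^(n+1) is [col_mx x tau%:M]. *)
Definition ext_cone K : set 'cV[R]_(n + 1) :=
  [set xb | K (usubmx xb) /\ 0 <= dsubmx xb 0 0].

End Cones.

Section Barriers.
Context {R : realType} {n : nat}.
Implicit Types (F : 'cV[R]_n -> R) (K : set 'cV[R]_n) (x u : 'cV[R]_n).

Definition grad F x : 'cV[R]_n := \col_i 'D_(delta_mx i 0) F x.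

Definition hess F x : 'M[R]_n :=
  \matrix_(i, j) 'D_(delta_mx j 0) (fun y => grad F y i 0) x.

Definition lnorm F x u : R := enorm (sqrtmx (hess F x) *m u).

Definition lnormD F x u : R := enorm (invmx (sqrtmx (hess F x)) *m u).

Definition lball F x u (r : R) : set 'cV[R]_n :=
  [set v | lnorm F x (v - u) < r].

(* A function K° -> R is a total function of which only the values on K° are
   constrained; as K° is open, its derivatives there depend on nothing else. *)
Definition C2_on K F : Prop :=
  forall x, K° x ->
    [/\ differentiable F x, differentiable (grad F) x &
        {for x, continuous (hess F)}].

Definition self_concordant K F : Prop :=
  [/\ C2_on K F,
      (forall x, K° x -> pdmx (hess F x)) &
      forall x, K° x ->
        lball F x x 1 `<=` K° /\
        forall u v, lball F x x 1 u -> v != 0 ->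
          1 - lnorm F x (u - x) <= lnorm F u v / lnorm F x v
            <= 1 / (1 - lnorm F x (u - x))].

Definition log_hom_barrier K F (nu : R) : Prop :=
  [/\ self_concordant K F,
      ereal_sup [set ((lnormD F x (grad F x)) ^+ 2)%:E | x in K°] = nu%:E &
      forall x t, K° x -> 0 < t -> F (t *: x) = F x - nu * ln t].

End Barriers.

Section HomogeneousModel.
Context {R : realType} {n m : nat}.

(* z = (xbar; y; sbar) *)
Definition pd_point : Type := 'cV[R]_(n + 1) * 'cV[R]_m * 'cV[R]_(n + 1).

Implicit Types (F : 'cV[R]_n -> R) (K : set 'cV[R]_n) (nu t : R).
Implicit Types (xb sb : 'cV[R]_(n + 1)) (z D : pd_point).
Implicit Types (A : 'M[R]_(m, n)) (b : 'cV[R]_m) (c : 'cV[R]_n).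

Definition xbar z : 'cV[R]_(n + 1) := z.1.1.
Definition ypart z : 'cV[R]_m := z.1.2.
Definition sbar z : 'cV[R]_(n + 1) := z.2.

Definition ext_barrier F xb : R := F (usubmx xb) - ln (dsubmx xb 0 0).

Definition calF K : set pd_point :=
  [set z | ext_cone K (xbar z) /\ ext_cone (dual_cone K) (sbar z)].

Definition Gmx A b c : 'M[R]_(m + (n + 1)) :=
  block_mx 0                    (row_mx A (- b))
           (col_mx (- A^T) b^T) (block_mx 0       c
                                          (- c^T) 0).

Definition mu nu z : R := inner (xbar z) (sbar z) / (nu + 1).

Definition psi F xb sb t : 'cV[R]_(n + 1) :=
  sb + t *: grad (ext_barrier F) xb.

Definition psiz F nu z : 'cV[R]_(n + 1) := psi F (xbar z) (sbar z) (mu nu z).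

Definition calN K F nu (theta : R) : set pd_point :=
  [set z | (calF K)° z /\
    lnormD (ext_barrier F) (xbar z) (psiz F nu z) <= theta * mu nu z].

Definition corrector_system F nu A b c z D : Prop :=
  Gmx A b c *m col_mx (ypart D) (xbar D) - col_mx 0 (sbar D) = 0 /\
  sbar D + mu nu z *: (hess (ext_barrier F) (xbar z) *m xbar D)
    = - psiz F nu z.

Definition corrector_step F nu A b c (alpha : R) z z' : Prop :=
  exists D, corrector_system F nu A b c z D /\ z' = z + alpha *: D.

Fixpoint corrector_phase F nu A b c (alpha : R) (r : nat) z z' : Prop :=
  if r is r'.+1 then
    exists z1, corrector_step F nu A b c alpha z z1 /\
               corrector_phase F nu A b c alpha r' z1 z'
  else z' = z.

End HomogeneousModel.

Arguments pd_point : clear implicits.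

(* Main.v *)
Require Import Defs.
From HB Require Import structures.
From mathcomp Require Import all_boot all_order all_algebra ring lra.
From mathcomp Require Import complex.
From mathcomp Require Import all_classical all_reals all_analysis.

(** Write x, s for the extended primal and dual parts of z, mu for its normalized
    gap, N = nu + 1 for the parameter of the extended barrier, g and H for its
    gradient and Hessian, and (dx; dy; ds) for the corrector direction. Norms of
    directions are local norms at x, norms of gradients and of residuals are the
    corresponding dual norms.

    Because the matrix of the model is skew, dx and ds are orthogonal. Pairing
    the Newton equation ds + mu H dx = - psi with dx then gives
    mu |dx|^2 = - <dx, psi>, so that delta = |dx| is at most the radius beta of
    the neighbourhood ([corrector_length_le]). In particular delta < 1, and
    self-concordance keeps x + dx in the interior of the cone. The homogeneity
    identities <g(x), x> = - N and H x = - g give the new gap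
    mu' = mu (1 - delta^2 / N) ([corrector_gap]) and the new residual
<<
      psi' = mu (g(x + dx) - g(x) - H dx) - mu (delta^2 / N) g(x + dx).
>>
    The Taylor remainder of the gradient is at most delta^2 / (1 - delta)
    ([grad_taylor_le]), and passing to the norm at x + dx costs one more factor
    1 / (1 - delta); since |g| = sqrt N at every point,
    |psi'| <= mu (delta^2 / (1 - delta)^2 + delta^2 / sqrt N)
    ([corrector_residual_le]). A cone that is pointed in positive dimension has
    nu >= 1, hence N >= 2 ([barrier_param_ge1]), and with this bound each of the
    three steps concerned (radius 0.20 to 0.10, then 0.25 to 0.175 to 0.1225) is
    a numerical inequality.

    It remains to see that the new dual point is interior. Along a ray x + t v
    with v in the cone the slope of the barrier stays nonpositive while its
    derivative is at least |v|^2 / (1 + t |v|)^2, whence |v| <= - <g(x), v>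
    ([lnorm_le_grad]). So the dual ball of radius mu' around - mu' g(x + dx),
    which contains s + ds, lies in the dual cone ([dual_cone_interior]).

    The local norms are defined through a square root of the Hessian, whose
    existence comes from diagonalizing a real symmetric matrix over the complex
    numbers ([pdmx_sqrt]); afterwards only the quadratic forms
    <u, H u> and the duality between the two norms are used. All of this is done
    for an arbitrary barrier ([barrier_on]), and [ext_barrier_on] shows that the
    extended barrier is one. The corrector system has a unique solution because
    its matrix, after elimination of ds, is the sum of a skew matrix and a
    positive semidefinite one, and [A] has full row rank ([corrector_mx_unit]). *)

Set Implicit Arguments.
Unset Strict Implicit.
Unset Printing Implicit Defensive.
Import Order.TTheory GRing.Theory Num.Theory.
Import numFieldNormedType.Exports.
Local Open Scope classical_set_scope.
Local Open Scope ring_scope.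

(** * The Euclidean inner product *)

Section InnerProduct.
Context {R : realType} {n : nat}.
Implicit Types (u v w : 'cV[R]_n) (M : 'M[R]_n) (a : R).

Lemma innerE u v : inner u v = \sum_i u i 0 * v i 0.
Proof. by rewrite /inner mxE; apply: eq_bigr => i _; rewrite mxE. Qed.

Lemma innerC u v : inner u v = inner v u.
Proof. by rewrite !innerE; apply: eq_bigr => i _; rewrite mulrC. Qed.

Lemma innerDr u v w : inner u (v + w) = inner u v + inner u w.
Proof. by rewrite /inner mulmxDr mxE. Qed.

Lemma innerZr a u v : inner u (a *: v) = a * inner u v.
Proof. by rewrite /inner -scalemxAr mxE. Qed.

Lemma innerNr u v : inner u (- v) = - inner u v.
Proof. by rewrite /inner mulmxN mxE. Qed.

Lemma innerBr u v w : inner u (v - w) = inner u v - inner u w.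
Proof. by rewrite innerDr innerNr. Qed.

Lemma innerDl u v w : inner (u + v) w = inner u w + inner v w.
Proof. by rewrite innerC innerDr !(innerC w). Qed.

Lemma innerZl a u v : inner (a *: u) v = a * inner u v.
Proof. by rewrite innerC innerZr innerC. Qed.

Lemma innerNl u v : inner (- u) v = - inner u v.
Proof. by rewrite innerC innerNr innerC. Qed.

Lemma innerBl u v w : inner (u - v) w = inner u w - inner v w.
Proof. by rewrite innerDl innerNl. Qed.

Lemma inner0r u : inner u 0 = 0.
Proof. by rewrite /inner mulmx0 mxE. Qed.

Lemma inner0l u : inner 0 u = 0.
Proof. by rewrite innerC inner0r. Qed.

Lemma inner_ge0 u : 0 <= inner u u.
Proof. by rewrite innerE sumr_ge0// => i _; rewrite -expr2 sqr_ge0. Qed.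

Lemma inner_eq0 u : (inner u u == 0) = (u == 0).
Proof.
apply/eqP/eqP => [|->]; last exact: inner0r.
rewrite innerE => /eqP; rewrite psumr_eq0 => [/allP u0|i _]; last first.
  by rewrite -expr2 sqr_ge0.
apply/colP => i; have /= := u0 i (mem_index_enum _).
by rewrite mulf_eq0 orbb mxE => /eqP.
Qed.

End InnerProduct.

Lemma inner_mxl (R : realType) (m n : nat) (M : 'M[R]_(m, n)) u v :
  inner (M^T *m u) v = inner u (M *m v).
Proof. by rewrite /inner trmx_mul trmxK mulmxA. Qed.

Lemma inner_inj (R : realType) (n : nat) (a b : 'cV[R]_n) :
  (forall w, inner w a = inner w b) -> a = b.
Proof.
move=> ab; apply/eqP; rewrite -subr_eq0 -inner_eq0 innerBr !ab subrr//.
Qed.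

Lemma inner_col_mx (R : realType) (p q : nat) (a a' : 'cV[R]_p) (e e' : 'cV[R]_q) :
  inner (col_mx a e) (col_mx a' e') = inner a a' + inner e e'.
Proof. by rewrite /inner tr_col_mx mul_row_col mxE. Qed.

(** * Square roots of positive definite matrices *)

Lemma poly_interpolation (F : fieldType) (s : seq F) (f : F -> F) :
  exists q : {poly F}, {in s, forall x, q.[x] = f x}.
Proof.
elim: s => [|a s [q qE]]; first by exists 0.
have [as_|aNs] := boolP (a \in s).
  by exists q => x; rewrite inE => /orP[/eqP ->|]; exact: qE.
pose w := \prod_(b <- s) ('X - b%:P).
have wa : w.[a] != 0.
  by apply: contra aNs => wa0; rewrite -root_prod_XsubC.
exists (q + ((f a - q.[a]) / w.[a]) *: w) => x.
rewrite inE hornerD hornerZ => /orP[/eqP ->|xs].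
  by rewrite divfK// addrC subrK.
rewrite qE//; have /rootP -> : root w x by rewrite root_prod_XsubC.
by rewrite mulr0 addr0.
Qed.

(** This replaces a real spectral theorem: over the complex numbers [M] is
    unitarily diagonalizable and its eigenvalues are real, so a real polynomial
    vanishing at them kills the diagonal form of [M], hence [M] itself. *)
Lemma symmetric_real_annihilator (R : realType) (n : nat) (M : 'M[R]_n.+1) :
  M^T = M ->
  exists s : seq R, {in s, forall a, eigenvalue M a} /\
    forall p : {poly R}, {in s, forall a, p.[a] = 0} -> horner_mx M p = 0.
Proof.
move=> Msym.
pose toC : {rmorphism R -> R[i]} := real_complex R.
pose MC := map_mx toC M.
have MCherm : MC \is hermsymmx.
  apply: realsym_hermsym.
    apply/is_hermitianmxP; rewrite expr0 scale1r map_mx_id// /MC.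
    by rewrite -[LHS]/(map_mx toC M) -{1}Msym map_trmx.
  by apply/mxOverP => i j; rewrite mxE; apply/complex_realP; exists (M i j).
have /hermitian_normalmx/orthomx_spectralP MCE := MCherm.
set P := spectralmx MC in MCE; set d := spectral_diag MC in MCE.
have Pu : P \in unitmx by exact: spectral_unit.
have dreal i : exists r, d 0 i = toC r.
  have /mxOverP/(_ 0 i) := @hermitian_spectral_diag_real _ _ _ MCherm.
  by move=> /complex_realP[r ->]; exists r.
have [r rE] := choice dreal.
exists [seq r i | i <- enum 'I_n.+1]; split.
  move=> _ /mapP[i _ ->].
  rewrite eigenvalue_root_char -(fmorph_root toC) map_char_poly -rE.
  rewrite -eigenvalue_root_char; apply/eigenvalueP; exists (row i P); last first.
    rewrite rowE mulmx_free_eq0 ?row_free_unit//.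
    by apply/negP => /eqP/matrixP/(_ 0 i); rewrite !mxE !eqxx => /eqP; rewrite oner_eq0.
  rewrite -/MC -row_mul {1}MCE !mulmxA mulmxV// mul1mx row_mul row_diag_mx.
  by rewrite -scalemxAl rowE.
move=> p p0; apply: (map_mx_inj (f := toC)).
rewrite map_horner_mx map_mx0 -[map_mx toC M]/MC MCE
  (horner_mx_uconjC _ _ Pu) horner_mx_diag.
suff -> : map_mx (horner (map_poly toC p)) d = 0.
  rewrite (_ : diag_mx 0 = 0) ?mulmx0 ?mul0mx//.
  by apply/matrixP => i j; rewrite !mxE mul0rn.
apply/rowP => i; rewrite !mxE rE horner_map p0 ?rmorph0//.
by apply/mapP; exists i; rewrite ?mem_enum.
Qed.

(** The root is [T *m T] where [T] is a polynomial in [M] whose value at each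
    eigenvalue [a] of [M] is the fourth root of [a]. Polynomials in [M] are real
    and symmetric, so squaring [T] makes positive semidefiniteness immediate. *)
Lemma pdmx_sqrt (R : realType) (n : nat) (M : 'M[R]_n) : pdmx M ->
  exists S, psdmx S /\ S *m S = M.
Proof.
case: n M => [|n] M [Msym Mpos].
  exists 0; split; last by rewrite mulmx0; apply/esym/flatmx0.
  by split=> [|u]; rewrite ?trmx0// mul0mx /inner mulmx0 mxE.
have [s [seig sann]] := symmetric_real_annihilator Msym.
have spos a : a \in s -> 0 <= a.
  move=> /seig/eigenvalueP[v vM v0].
  have vT0 : v^T != 0 by rewrite -(inj_eq (can_inj (@trmxK _ _ _))) trmxK trmx0.
  have := Mpos _ vT0; rewrite /inner trmxK mulmxA vM -scalemxAl mxE.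
  have -> : (v *m v^T) 0 0 = inner v^T v^T by rewrite /inner trmxK.
  case: (lerP 0 a) => // a0; have := inner_ge0 v^T => i0.
  by rewrite ltNge (mulr_le0_ge0 (ltW a0) i0).
have [q qE] := poly_interpolation s (fun a => Num.sqrt (Num.sqrt a)).
pose T := horner_mx M q.
have TsymP (p : {poly R}) : (horner_mx M p)^T = horner_mx M p.
  elim/poly_ind: p => [|p c IH]; first by rewrite rmorph0 trmx0.
  rewrite rmorphD rmorphM/= horner_mx_X horner_mx_C linearD/= tr_scalar_mx.
  rewrite -[_ * M]/(_ *m M) trmx_mul IH Msym.
  have -> // : M *m horner_mx M p = horner_mx M p *m M.
  exact/comm_mx_horner.
exists (T *m T); split; first split.
- by rewrite trmx_mul TsymP.
- by move=> u; rewrite -mulmxA -inner_mxl TsymP inner_ge0.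
- have : horner_mx M (q * q * (q * q) - 'X) = 0.
    apply: sann => a sa; have a0 := spos _ sa.
    have -> : (q * q * (q * q) - 'X).[a] = (q.[a] ^+ 2) ^+ 2 - a.
      by rewrite hornerD hornerN !hornerM hornerX; ring.
    by rewrite qE// !sqr_sqrtr ?sqrtr_ge0// subrr.
  by rewrite rmorphB !rmorphM/= horner_mx_X => /eqP; rewrite subr_eq0 => /eqP.
Qed.

(** * The norm of a positive definite matrix and its dual *)

Section EuclideanNorm.
Context {R : realType} {n : nat}.
Implicit Types (u v w : 'cV[R]_n) (M : 'M[R]_n) (a : R).

Lemma enorm_ge0 u : 0 <= enorm u.
Proof. exact: sqrtr_ge0. Qed.

Lemma sqr_enorm u : enorm u ^+ 2 = inner u u.
Proof. by rewrite sqr_sqrtr ?inner_ge0. Qed.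

Lemma enorm_eq0 u : (enorm u == 0) = (u == 0).
Proof. by rewrite -inner_eq0 -sqr_enorm sqrf_eq0. Qed.

Lemma enormZ a u : enorm (a *: u) = `|a| * enorm u.
Proof.
rewrite /enorm innerZl innerZr mulrA -expr2 sqrtrM ?sqr_ge0//.
by rewrite sqrtr_sqr.
Qed.

Lemma inner_le_enorm u v : inner u v <= enorm u * enorm v.
Proof.
have [->|u0] := eqVneq u 0; first by rewrite inner0l mulr_ge0 ?enorm_ge0.
have [->|v0] := eqVneq v 0; first by rewrite inner0r mulr_ge0 ?enorm_ge0.
have a0 : 0 < enorm u by rewrite lt_def enorm_eq0 u0 enorm_ge0.
have b0 : 0 < enorm v by rewrite lt_def enorm_eq0 v0 enorm_ge0.
have := inner_ge0 (enorm v *: u - enorm u *: v).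
rewrite !(innerBr, innerBl, innerZl, innerZr) -!sqr_enorm (innerC v u).
move: (enorm u) (enorm v) (inner u v) a0 b0 => a b c a0 b0 h.
have : 0 <= a * b * (a * b - c) * 2 by nra.
by rewrite pmulr_lge0// pmulr_rge0 ?mulr_gt0// subr_ge0.
Qed.

End EuclideanNorm.

Lemma enorm_mx_continuous (R : realType) (n : nat) (M : 'M[R]_n) (c : 'cV[R]_n) :
  continuous (fun s : 'cV[R]_n => enorm (M *m (s + c))).
Proof.
have entry i : continuous (fun s : 'cV[R]_n => (M *m (s + c)) i 0).
  have -> : (fun s => (M *m (s + c)) i 0) =
      (fun s => \sum_j M i j * (s j 0 + c j 0)).
    by apply: funext => u; rewrite mxE; apply: eq_bigr => j _; rewrite mxE.
  apply: continuous_big => [|j _ s]; first exact: add_continuous.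
  exact: (cvgM (cvg_cst (M i j))
               (cvgD (@coord_continuous R n 1 j 0 s) (cvg_cst (c j 0)))).
have sqr : continuous (fun s : 'cV[R]_n => inner (M *m (s + c)) (M *m (s + c))).
  have -> : (fun s : 'cV[R]_n => inner (M *m (s + c)) (M *m (s + c))) =
      (fun s => \sum_j (M *m (s + c)) j 0 * (M *m (s + c)) j 0).
    by apply: funext => u; rewrite innerE.
  apply: continuous_big => [|j _ s]; first exact: add_continuous.
  exact: (cvgM (entry j s) (entry j s)).
move=> s.
exact: (continuous_comp (f := fun u => inner _ _) (sqr s) (@sqrt_continuous R _)).
Qed.

Section MatrixNorm.
Context {R : realType} {n : nat}.
Implicit Types (u v w p : 'cV[R]_n) (M Q : 'M[R]_n) (a c : R).

(** [lnorm F x] and [lnormD F x] are these two norms at [hess F x], by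
    conversion; here only positive definiteness of the matrix matters. *)
Definition mxnorm M u : R := enorm (sqrtmx M *m u).
Definition mxnormD M u : R := enorm (invmx (sqrtmx M) *m u).

Lemma mxnorm0 M : mxnorm M 0 = 0.
Proof. by rewrite /mxnorm mulmx0 /enorm inner0r sqrtr0. Qed.

Lemma pdmx_unit M : pdmx M -> M \in unitmx.
Proof.
move=> [Msym Mpos]; rewrite -row_free_unit -kermx_eq0.
apply/negPn/negP => /rowV0Pn[v /sub_kermxP vM v0].
have := Mpos v^T; rewrite -{1}Msym -trmx_mul vM trmx0 inner0r ltxx.
by rewrite -(inj_eq (can_inj (@trmxK _ _ _))) trmxK trmx0 => /(_ v0).
Qed.

Section PositiveDefinite.
Variables (M : 'M[R]_n) (Mpd : pdmx M).

Lemma sqrtmxP : psdmx (sqrtmx M) /\ sqrtmx M *m sqrtmx M = M.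
Proof.
by have := xgetPex 0 (pdmx_sqrt Mpd); rewrite -/(sqrtmx M).
Qed.

Lemma sqrtmx_unit : sqrtmx M \in unitmx.
Proof.
by have := pdmx_unit Mpd; rewrite -[X in X \in _]sqrtmxP.2 unitmx_mul => /andP[].
Qed.

Lemma inner_sqrtmx u v : inner (sqrtmx M *m u) (sqrtmx M *m v) = inner u (M *m v).
Proof.
have [[Ssym _] SS] := sqrtmxP.
by rewrite -{1}Ssym inner_mxl mulmxA SS.
Qed.

Lemma sqr_mxnorm u : mxnorm M u ^+ 2 = inner u (M *m u).
Proof. by rewrite sqr_enorm inner_sqrtmx. Qed.

Lemma mxnorm_ge0 u : 0 <= mxnorm M u.
Proof. exact: enorm_ge0. Qed.

Lemma mxnorm_eq0 u : (mxnorm M u == 0) = (u == 0).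
Proof.
rewrite enorm_eq0; apply/eqP/eqP => [Su0|->]; last by rewrite mulmx0.
by rewrite -[u](mulKmx sqrtmx_unit) Su0 mulmx0.
Qed.

Lemma mxnorm_gt0 u : (0 < mxnorm M u) = (u != 0).
Proof. by rewrite lt_def mxnorm_eq0 mxnorm_ge0 andbT. Qed.

Lemma mxnormZ a u : mxnorm M (a *: u) = `|a| * mxnorm M u.
Proof. by rewrite /mxnorm -scalemxAr enormZ. Qed.

Lemma mxnormN u : mxnorm M (- u) = mxnorm M u.
Proof. by rewrite -scaleN1r mxnormZ normrN1 mul1r. Qed.

Lemma inner_le_mxnorm u p : inner u p <= mxnorm M u * mxnormD M p.
Proof.
apply: le_trans (inner_le_enorm _ _); rewrite le_eqVlt; apply/orP; left.
have [[Ssym _] _] := sqrtmxP; apply/eqP.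
by rewrite -{1}Ssym inner_mxl mulKVmx// sqrtmx_unit.
Qed.

(** With [inner_le_mxnorm], this characterizes the dual norm by duality, so that
    dual norms taken at different points can be compared without inverting
    matrices. The extremal [w] is the Riesz representative of [p]. *)
Lemma mxnormD_le c p : 0 <= c -> (forall w, inner w p <= c * mxnorm M w) ->
  mxnormD M p <= c.
Proof.
move=> c0 /(_ (invmx (sqrtmx M) *m (invmx (sqrtmx M) *m p))).
have [[Ssym _] _] := sqrtmxP.
rewrite /mxnorm mulKVmx ?sqrtmx_unit// -/(mxnormD M p).
have invsym : (invmx (sqrtmx M))^T = invmx (sqrtmx M) by rewrite trmx_inv Ssym.
rewrite -{1}invsym inner_mxl -sqr_enorm -/(mxnormD M p) expr2.
have := enorm_ge0 (invmx (sqrtmx M) *m p); rewrite -/(mxnormD M p).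
by rewrite le_eqVlt => /orP[/eqP <-//|p0]; rewrite ler_pM2r.
Qed.

Lemma mxnormD_mul u : mxnormD M (M *m u) = mxnorm M u.
Proof.
by rewrite /mxnormD -{2}sqrtmxP.2 -mulmxA mulKmx// sqrtmx_unit.
Qed.

(** Polarization: the bound on the diagonal is applied to the sum and to the
    difference of [w] and [v], rescaled to the same norm. *)
Lemma bilinear_le_mxnorm Q c : Q^T = Q ->
  (forall w, `|inner w (Q *m w)| <= c * inner w (M *m w)) ->
  forall w v, inner w (Q *m v) <= c * (mxnorm M w * mxnorm M v).
Proof.
move=> Qsym Qle w v.
have [->|w0] := eqVneq w 0; first by rewrite inner0l mxnorm0 mul0r mulr0.
have [->|v0] := eqVneq v 0; first by rewrite mulmx0 inner0r mxnorm0 !mulr0.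
have a0 : 0 < mxnorm M w by rewrite mxnorm_gt0.
have b0 : 0 < mxnorm M v by rewrite mxnorm_gt0.
have := le_trans (ler_norm _) (Qle (mxnorm M v *: w + mxnorm M w *: v)).
have /ler_normlP[+ _] := Qle (mxnorm M v *: w - mxnorm M w *: v).
rewrite !(mulmxDr, mulmxN) -!scalemxAr.
rewrite !(innerDr, innerDl, innerNr, innerNl, innerZl, innerZr) -!sqr_mxnorm.
have -> : inner v (Q *m w) = inner w (Q *m v) by rewrite -{1}Qsym innerC inner_mxl.
have -> : inner v (M *m w) = inner w (M *m v) by rewrite -{1}Mpd.1 innerC inner_mxl.
move: (mxnorm M w) (mxnorm M v) a0 b0 => a b a0 b0 h1 h2.
have : 0 <= a * b * (c * (a * b) - inner w (Q *m v)) by nra.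
by rewrite pmulr_rge0 ?mulr_gt0// subr_ge0.
Qed.

End PositiveDefinite.

(** The form of [N - M] lies between [a^2 - 1] and [a^-2 - 1] times that of [M],
    and [1 - a^2 <= a^-2 - 1]. *)
Lemma pdmx_diff_le M N a : pdmx M -> pdmx N -> 0 < a -> a <= 1 ->
  (forall y, a * mxnorm M y <= mxnorm N y) ->
  (forall y, a * mxnorm N y <= mxnorm M y) ->
  forall w v, inner w ((N - M) *m v) <= (a ^- 2 - 1) * (mxnorm M w * mxnorm M v).
Proof.
move=> HM HN a0 a1 MN NM.
have Qsym : (N - M)^T = N - M by rewrite linearB/= HM.1 HN.1.
apply: (bilinear_le_mxnorm HM Qsym) => y.
rewrite mulmxBl innerBr -(sqr_mxnorm HN) -(sqr_mxnorm HM).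
have := MN y; have := NM y.
have := mxnorm_ge0 M y; have := mxnorm_ge0 N y.
move: (mxnorm N y) (mxnorm M y) => q p q0 p0 h1 h2.
have h1' : (a * q) ^+ 2 <= p ^+ 2 by rewrite ler_sqr ?nnegrE// mulr_ge0// ltW.
have h2' : (a * p) ^+ 2 <= q ^+ 2 by rewrite ler_sqr ?nnegrE// mulr_ge0// ltW.
rewrite !exprMn in h1' h2'.
have A0 : 0 < a ^+ 2 by rewrite exprn_gt0.
have A1 : a ^+ 2 <= 1 by rewrite exprn_ile1// ltW.
have A2 : 0 <= a ^- 2 - 1 - (1 - a ^+ 2).
  have -> : a ^- 2 - 1 - (1 - a ^+ 2) = (1 - a ^+ 2) ^+ 2 / a ^+ 2.
    by field; exact: lt0r_neq0.
  by rewrite divr_ge0// ?sqr_ge0// ltW.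
have p2 := sqr_ge0 p; have q2 := sqr_ge0 q.
have h3 : q ^+ 2 <= a ^- 2 * p ^+ 2 by rewrite mulrC ler_pdivlMr// mulrC.
move: (a ^+ 2) (a ^- 2) (p ^+ 2) (q ^+ 2) A0 A1 A2 p2 q2 h1' h2' h3.
move=> A B P Q A0 A1 A2 P0 Q0 h1' h2' h3.
by rewrite ler_norml; apply/andP; split; nra.
Qed.

End MatrixNorm.

(** * Derivatives along lines *)

Section DirectionalDerivatives.
Context {R : realType}.

(** [Laff] says that [L] is affine along the line through [x] in direction [v],
    with slope [w]; the difference quotients then coincide exactly. *)
Lemma is_derive_affine (V W U : normedModType R) (f : W -> U) (L : V -> W)
    (x v : V) (w : W) (d : U) :
  (forall h : R, L (h *: v + x) = h *: w + L x) ->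
  is_derive (L x) w f d -> is_derive x v (f \o L) d.
Proof.
move=> Laff [df fd].
have E : (fun h : R => h^-1 *: (((f \o L) \o shift x) (h *: v) - (f \o L) x))
       = (fun h : R => h^-1 *: ((f \o shift (L x)) (h *: w) - f (L x))).
  by apply: funext => h /=; rewrite Laff.
split; first by rewrite /derivable E.
by rewrite /derive E.
Qed.

Lemma is_derive_line (W U : normedModType R) (f : W -> U) (x v : W) (t : R) (d : U) :
  is_derive (x + t *: v) v f d ->
  is_derive t 1 (fun s : R => f (x + s *: v)) d.
Proof.
apply: (@is_derive_affine R^o W U f (fun s : R => x + s *: v)) => h.
by rewrite scalerDl addrCA -[h%:A]/(h * 1) mulr1.
Qed.

Lemma is_derive_mull (c t : R) : is_derive t 1 (fun s : R => c * s) c.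
Proof. by have := is_deriveZ c (@is_derive_id R R^o t 1); rewrite [_ *: _]mulr1. Qed.

(** A mean value argument that avoids integrals: below, an integral estimate is
    always replaced by the monotonicity of a difference with an explicit
    primitive. *)
Lemma derive_ge0_le (f df : R -> R) (a b : R) : a <= b ->
  (forall t, t \in `[a, b]%R -> is_derive t 1 f (df t)) ->
  (forall t, t \in `]a, b[%R -> 0 <= df t) -> f a <= f b.
Proof.
move=> ab fd df0; move: ab; rewrite le_eqVlt => /orP[/eqP -> //|ab].
have sub t : t \in `]a, b[%R -> t \in `[a, b]%R by apply: subset_itv_oo_cc.
have [|t tab fE] := MVT ab (fun t tab => fd t (sub t tab)).
  apply: derivable_within_continuous => t tab.
  by have [] := fd t tab.
by rewrite -subr_ge0 fE mulr_ge0 ?df0// subr_ge0 ltW.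
Qed.

Lemma is_derive_grad (n : nat) (f : 'cV[R]_n -> R) (x v : 'cV[R]_n) :
  differentiable f x -> is_derive x v f (inner (grad f x) v).
Proof.
move=> df; split; first exact: diff_derivable.
rewrite deriveE//.
have -> : v = \sum_i v i 0 *: delta_mx i 0.
  apply/colP => i; rewrite summxE (bigD1 i)//= !mxE !eqxx mulr1 big1 ?addr0// => j ji.
  by rewrite !mxE eq_sym (negbTE ji) mulr0.
rewrite linear_sum innerE; apply: eq_bigr => i _.
rewrite linearZ/= -deriveE// !mxE summxE (bigD1 i)//= !mxE !eqxx mulr1 big1 ?addr0.
  by rewrite mulrC.
by move=> j ji; rewrite !mxE eq_sym (negbTE ji) mulr0.
Qed.

End DirectionalDerivatives.

(** * Self-concordant logarithmically homogeneous barriers *)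

(** What the proof uses of [log_hom_barrier], in a form that passes to the
    extended barrier by direct computation. Derivatives are directional, the
    two-sided norm comparison is free of quotients, and the domain is an
    arbitrary open set: it will be the interior of a cone, or the product of
    one with the positive half-line. The value of [nu] as a supremum is
    recovered from homogeneity in [sqr_lnormD_grad]. *)
Record barrier_on (R : realType) (n : nat) (D : set 'cV[R]_n)
    (F : 'cV[R]_n -> R) (nu : R) : Prop := BarrierOn {
  barrier_open : open D;
  barrier_grad : forall x v, D x -> is_derive x v F (inner (grad F x) v);
  barrier_hess : forall x v i, D x ->
    is_derive x v (fun y => grad F y i 0) ((hess F x *m v) i 0);
  barrier_pd : forall x, D x -> pdmx (hess F x);
  barrier_ball : forall x, D x -> lball F x x 1 `<=` D;
  barrier_norm_ge : forall x u v, D x -> lball F x x 1 u ->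
    (1 - lnorm F x (u - x)) * lnorm F x v <= lnorm F u v;
  barrier_norm_le : forall x u v, D x -> lball F x x 1 u ->
    (1 - lnorm F x (u - x)) * lnorm F u v <= lnorm F x v;
  barrier_hom : forall x t, D x -> 0 < t -> F (t *: x) = F x - nu * ln t
}.

Lemma log_hom_barrier_on (R : realType) (n : nat) (K : set 'cV[R]_n)
    (F : 'cV[R]_n -> R) (nu : R) :
  log_hom_barrier K F nu -> barrier_on K° F nu.
Proof.
move=> [[C2 Hpd sc] _ hom].
have lnorm0 y : lnorm F y 0 = 0 by exact: mxnorm0.
have ratio x u v : K° x -> lball F x x 1 u ->
    (1 - lnorm F x (u - x)) * lnorm F x v <= lnorm F u v /\
    (1 - lnorm F x (u - x)) * lnorm F u v <= lnorm F x v.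
  move=> Kx ux; have [ball rat] := sc x Kx.
  have [->|v0] := eqVneq v 0; first by rewrite !lnorm0 mulr0.
  have p0 : 0 < lnorm F x v by rewrite (mxnorm_gt0 (Hpd x Kx)).
  have := rat u v ux v0; have : lnorm F x (u - x) < 1 by exact: ux.
  move: (lnorm F x (u - x)) (lnorm F u v) (lnorm F x v) p0 => r q p p0 r1.
  have r0 : 0 < 1 - r by rewrite subr_gt0.
  rewrite ler_pdivlMr// ler_pdivrMr// => /andP[-> +].
  by rewrite mul1r mulrC ler_pdivlMr// mulrC.
split.
- exact: open_interior.
- by move=> x v /C2[dF _ _]; exact: is_derive_grad.
- move=> x v i /C2[_ dg _].
  have di : differentiable (fun y => grad F y i 0) x.
    exact: (differentiable_comp dg (differentiable_coord _ _ _)).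
  have -> : (hess F x *m v) i 0 = inner (grad (fun y => grad F y i 0) x) v.
    by rewrite mxE innerE; apply: eq_bigr => j _; rewrite !mxE.
  exact: is_derive_grad.
- exact: Hpd.
- by move=> x Kx; exact: (sc x Kx).1.
- by move=> x u v Kx ux; exact: (ratio x u v Kx ux).1.
- by move=> x u v Kx ux; exact: (ratio x u v Kx ux).2.
- exact: hom.
Qed.

Section BarrierCalculus.
Context {R : realType} {n : nat}.
Variables (D : set 'cV[R]_n) (F : 'cV[R]_n -> R) (nu : R).
Hypothesis FB : barrier_on D F nu.
Implicit Types (x u v w : 'cV[R]_n) (t : R).

Lemma near_line x v : D x -> \forall t \near (0 : R), D (x + t *: v).
Proof.
move=> Dx; have : (x + t *: v) @[t --> (0:R)] --> x + 0 *: v.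
  by apply: cvgD; [exact: cvg_cst|apply: cvgZr_tmp; exact: cvg_id].
rewrite scale0r addr0; apply; exact: (open_nbhs_nbhs (conj (barrier_open FB) Dx)).
Qed.

Lemma is_derive_inner_grad w x v : D x ->
  is_derive x v (fun y => inner w (grad F y)) (inner w (hess F x *m v)).
Proof.
move=> Dx.
have -> : (fun y => inner w (grad F y)) =
    \sum_i (w i 0 *: (fun y => grad F y i 0)).
  by apply: funext => y; rewrite fct_sumE innerE.
rewrite innerE; apply: is_derive_sum => i.
by apply: is_deriveZ; exact: (barrier_hess FB).
Qed.

Lemma is_derive_grad_line w x v t : D (x + t *: v) ->
  is_derive t 1 (fun s : R => inner w (grad F (x + s *: v)))
    (inner w (hess F (x + t *: v) *m v)).
Proof.
move=> Dt; apply: (@is_derive_line _ _ R^o (fun y => inner w (grad F y))).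
exact: is_derive_inner_grad.
Qed.

(** Euler's identity, from differentiating [t |-> F (t x)] at [1]. *)
Lemma inner_grad x : D x -> inner (grad F x) x = - nu.
Proof.
move=> Dx.
have dF : is_derive (1 : R) 1 (fun t : R => F (t *: x)) (inner (grad F x) x).
  apply: (@is_derive_affine R R^o 'cV[R]_n R^o F (fun t => t *: x) 1 1 x).
    by move=> h; rewrite scalerDl -[h%:A]/(h * 1) mulr1.
  by rewrite scale1r; exact: (barrier_grad FB).
have dln : is_derive (1 : R) 1 (fun t : R => F x - nu * ln t) (- nu).
  have := is_deriveB (@is_derive_cst R R^o R^o (F x) 1 1)
                     (is_deriveZ nu (is_derive1_ln ltr01)).
  by rewrite sub0r invr1 [_%:A]mulr1.
have FE : \forall t \near (1 : R), F x - nu * ln t = F (t *: x).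
  by apply: filterS (lt_nbhsr (@ltr01 R)) => t t0; rewrite (barrier_hom FB).
have [_ <-] := near_eq_is_derive FE dln.
by have [_ ->] := dF.
Qed.

(** Differentiating the identity [inner (grad F y) y = - nu] in an arbitrary
    direction [w], with the symmetry of the Hessian. *)
Lemma hess_mul_self x : D x -> hess F x *m x = - grad F x.
Proof.
move=> Dx; apply: inner_inj => w.
have d1 : is_derive (0 : R) 1 (fun t : R => inner x (grad F (x + t *: w)))
    (inner x (hess F x *m w)).
  have := is_derive_grad_line x (x := x) (v := w) (t := 0).
  by rewrite scale0r addr0; apply.
have d2 : is_derive (0 : R) 1 (fun t : R => inner w (grad F (x + t *: w)))
    (inner w (hess F x *m w)).
  have := is_derive_grad_line w (x := x) (v := w) (t := 0).
  by rewrite scale0r addr0; apply.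
have d3 := is_deriveD d1 (is_deriveM (is_derive_id (0:R) 1) d2).
have : \forall t \near (0 : R), cst (- nu) t =
    inner x (grad F (x + t *: w)) + t * inner w (grad F (x + t *: w)).
  apply: filterS (near_line w Dx) => t Dt.
  by rewrite -innerZl -innerDl innerC inner_grad.
move=> /near_eq_is_derive/(_ (is_derive_cst (- nu) (0 : R) (1 : R)))[_].
have [_ ->] := d3.
rewrite scale0r add0r scale0r addr0 [_%:A]mulr1 => /eqP.
rewrite addr_eq0 => /eqP E; rewrite innerNr -E.
by rewrite -{1}(barrier_pd FB Dx).1 innerC inner_mxl.
Qed.

End BarrierCalculus.

Section BarrierTheory.
Context {R : realType} {n : nat}.
Variables (D : set 'cV[R]_n) (F : 'cV[R]_n -> R) (nu : R).
Hypothesis FB : barrier_on D F nu.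
Implicit Types (x u v w : 'cV[R]_n) (t : R).

Lemma sqr_lnorm x v : D x -> lnorm F x v ^+ 2 = inner v (hess F x *m v).
Proof. by move=> Dx; exact: (sqr_mxnorm (barrier_pd FB Dx)). Qed.

Lemma sqr_lnorm_self x : D x -> lnorm F x x ^+ 2 = nu.
Proof.
move=> Dx; rewrite sqr_lnorm// (hess_mul_self FB Dx) innerNr innerC.
by rewrite (inner_grad FB Dx) opprK.
Qed.

(** As [grad F x = hess F x *m (- x)], the dual norm of the gradient is the norm
    of [x], which Euler's identity evaluates. *)
Lemma sqr_lnormD_grad x : D x -> lnormD F x (grad F x) ^+ 2 = nu.
Proof.
move=> Dx; have -> : grad F x = hess F x *m (- x).
  by rewrite mulmxN (hess_mul_self FB Dx) opprK.
rewrite -[lnormD F x _]/(mxnormD (hess F x) _) (mxnormD_mul (barrier_pd FB Dx)) mxnormN.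
exact: sqr_lnorm_self.
Qed.

Lemma hess_diff_le x u w v : D x -> lnorm F x (u - x) < 1 ->
  inner w ((hess F u - hess F x) *m v) <=
  ((1 - lnorm F x (u - x)) ^- 2 - 1) * (lnorm F x w * lnorm F x v).
Proof.
move=> Dx ux; have Du : D u by exact: (barrier_ball FB Dx).
have Hx := barrier_pd FB Dx; have Hu := barrier_pd FB Du.
apply: (pdmx_diff_le Hx Hu).
- by rewrite subr_gt0.
- by rewrite gerBl; exact: enorm_ge0.
- by move=> y; exact: (barrier_norm_ge FB y Dx ux).
- by move=> y; exact: (barrier_norm_le FB y Dx ux).
Qed.

(** By [hess_diff_le], the derivative of [inner w (grad F (x + t d))] differs from
    its value at [0] by at most [(1 - t r)^-2 - 1] times [r] times the norm of
    [w], where [r] is the norm of [d]. Integrated over [0 <= t <= 1] this gives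
    [r (1 / (1 - r) - 1) = r^2 / (1 - r)]. *)
Lemma grad_taylor_le x d w : D x -> lnorm F x d < 1 ->
  inner w (grad F (x + d) - grad F x - hess F x *m d) <=
  lnorm F x d ^+ 2 / (1 - lnorm F x d) * lnorm F x w.
Proof.
move=> Dx d1; set r := lnorm F x d in d1 *; set p := lnorm F x w.
have r0 : 0 <= r by exact: enorm_ge0.
have p0 : 0 <= p by exact: enorm_ge0.
(* The primitive of the bound minus the function it bounds. *)
pose phi t := p * ((1 - r * t)^-1 - r * t) -
  (inner w (grad F (x + t *: d)) - inner w (hess F x *m d) * t).
pose dphi t := p * (r * (1 - r * t) ^- 2 - r) -
  (inner w (hess F (x + t *: d) *m d) - inner w (hess F x *m d)).
have xtd t : t \in `[0, 1]%R -> lnorm F x (x + t *: d - x) = r * t /\ r * t < 1.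
  rewrite in_itv/= => /andP[t0 t1]; rewrite addrC addKr.
  rewrite -[lnorm F x _]/(mxnorm (hess F x) _) mxnormZ ger0_norm// mulrC; split=> //.
  by rewrite (le_lt_trans _ d1)// ler_piMr.
have Dt t : t \in `[0, 1]%R -> D (x + t *: d).
  move=> /xtd[e lt]; apply: (barrier_ball FB Dx).
  by rewrite /lball/= e.
have : phi 0 <= phi 1.
  apply: (@derive_ge0_le R phi dphi 0 1 ler01).
    move=> t t01; have [_ lt] := xtd t t01; have Dtd := Dt t t01.
    have nz : 1 - r * t != 0 by rewrite gt_eqF// subr_gt0.
    have d0 : is_derive t 1 (fun s : R => 1 - r * s) (- r).
      have := is_deriveB (@is_derive_cst R R^o R^o 1 t 1) (is_derive_mull r t).
      by rewrite sub0r.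
    have dg := is_derive_grad_line FB w Dtd.
    have dinv := @is_deriveV R (fun s : R => 1 - r * s) t (- r) 1 nz d0.
    have := is_deriveB (is_deriveZ p (is_deriveB dinv (is_derive_mull r t)))
      (is_deriveB dg (is_derive_mull (inner w (hess F x *m d)) t)).
    move=> H; apply: (@is_derive_eq R R^o R^o phi t 1 _ _ H).
    by rewrite /dphi scalerN scaleNr opprK [_ *: r]mulrC.
  move=> t /subset_itv_oo_cc t01; have [e lt] := xtd t t01.
  have := @hess_diff_le x (x + t *: d) w d Dx.
  rewrite e mulmxBl innerBr => /(_ lt) h.
  rewrite /dphi subr_ge0; apply: (le_trans h); rewrite -/r -/p.
  by move: ((1 - r * t) ^- 2) => c; rewrite le_eqVlt; apply/orP; left; apply/eqP; ring.
rewrite /phi !mulr1 !mulr0 scale1r scale0r addr0 !subr0 invr1 mulr1.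
rewrite !innerBr => h.
have -> : r ^+ 2 / (1 - r) * p = p * ((1 - r)^-1 - r) - p.
  by field; rewrite gt_eqF// subr_gt0.
lra.
Qed.
End BarrierTheory.

(** * The recession inequality and the interior of the dual cone *)

Section BarrierOnCone.
Context {R : realType} {n : nat}.
Variables (K D : set 'cV[R]_n) (F : 'cV[R]_n -> R) (nu : R).
Hypothesis FB : barrier_on D F nu.
Hypothesis KZ : forall t x, 0 <= t -> K x -> K (t *: x).
Hypothesis DZ : forall x t, D x -> 0 < t -> D (t *: x).
Hypothesis DK : forall x v, D x -> K v -> D (x + v).
Hypothesis subDK : D `<=` K.
Implicit Types (x y u v w : 'cV[R]_n) (t : R).

Lemma barrier_param_ge0 x : D x -> 0 <= nu.
Proof. by move=> Dx; rewrite -(sqr_lnorm_self FB Dx) sqr_ge0. Qed.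

Lemma barrier_domain_segment x y t : D x -> D y -> 0 <= t <= 1 ->
  D (x + t *: (y - x)).
Proof.
move=> Dx Dy /andP[t0]; rewrite le_eqVlt => /orP[/eqP ->|t1].
  by rewrite scale1r addrC subrK.
have -> : x + t *: (y - x) = (1 - t) *: x + t *: y.
  by rewrite scalerBr scalerBl scale1r addrA addrAC.
apply: DK; first by apply: DZ; rewrite ?subr_gt0.
by apply: KZ => //; exact: subDK.
Qed.

Lemma grad_monotone x y : D x -> D y ->
  inner (y - x) (grad F x) <= inner (y - x) (grad F y).
Proof.
move=> Dx Dy; set d := y - x.
have := @derive_ge0_le R (fun s : R => inner d (grad F (x + s *: d)))
  (fun s => inner d (hess F (x + s *: d) *m d)) 0 1 ler01.
rewrite scale0r scale1r addr0 {4}/d (addrC x (y - x)) subrK; apply.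
  move=> t /[!in_itv]/= t01; apply: (is_derive_grad_line FB).
  exact: barrier_domain_segment.
move=> t /subset_itv_oo_cc/[!in_itv]/= t01.
by rewrite -(sqr_lnorm FB) ?sqr_ge0//; exact: barrier_domain_segment.
Qed.

Lemma barrier_convex x y : D x -> D y ->
  inner (y - x) (grad F x) <= F y - F x.
Proof.
move=> Dx Dy; set d := y - x; set c := inner d (grad F x).
have := @derive_ge0_le R (fun s : R => F (x + s *: d) - c * s)
  (fun s => inner (grad F (x + s *: d)) d - c) 0 1 ler01.
rewrite scale0r scale1r addr0 {2}/d (addrC x (y - x)) subrK mulr0 mulr1 subr0.
move=> H; suff : F x <= F y - c by lra.
apply: H => t.
  move=> /[!in_itv]/= t01; apply: is_deriveB; last exact: is_derive_mull.
  apply: (@is_derive_line _ _ R^o F); apply: (barrier_grad FB).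
  exact: barrier_domain_segment.
rewrite in_itv/= => /andP[t0 t1]; rewrite subr_ge0 innerC /c.
have Dt : D (x + t *: d) by apply: barrier_domain_segment => //; rewrite !ltW.
have := grad_monotone Dx Dt.
by rewrite (addrC x) addrK !innerZl ler_pM2l.
Qed.

(** The negative gradient lies in the dual cone: by convexity [F] lies above its
    tangent at [x], while by homogeneity it does not increase from a point of the
    domain outwards along its ray, so the tangent cannot have positive slope
    there. Points of the cone are limits of points of the domain. *)
Lemma grad_le0 x v : D x -> K v -> inner v (grad F x) <= 0.
Proof.
move=> Dx Kv; have nu0 := barrier_param_ge0 Dx.
have gx : inner x (grad F x) = - nu by rewrite innerC (inner_grad FB Dx).
have interior_case y : D y -> inner y (grad F x) <= 0.
  move=> Dy; rewrite leNgt; apply/negP => gy0.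
  pose C := F y - F x - nu.
  (* The factor l is large enough for the ray to violate the tangent bound C. *)
  pose l : R := 1 + `|C| / inner y (grad F x).
  have l1 : 1 <= l by rewrite lerDl divr_ge0// ltW.
  have l0 : 0 < l by exact: lt_le_trans l1.
  have := barrier_convex Dx (DZ Dy l0).
  rewrite innerBl innerZl gx (barrier_hom FB Dy l0) opprK => H.
  have ln0 : 0 <= nu * ln l by rewrite mulr_ge0// ln_ge0.
  have : l * inner y (grad F x) = inner y (grad F x) + `|C|.
    by rewrite /l mulrDl mul1r divfK// gt_eqF.
  have := ler_norm C; rewrite {1}/C; lra.
rewrite leNgt; apply/negP => gv0.
pose e : R := inner v (grad F x) / (2 * (nu + 1)).
have e0 : 0 < e by rewrite divr_gt0// mulr_gt0//; lra.
have := interior_case (e *: x + v) (DK (DZ Dx e0) Kv).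
rewrite innerDl innerZl gx.
have : e * nu <= inner v (grad F x) / 2.
  rewrite /e invfM mulrA -mulrA ler_piMr//; first lra.
  by rewrite mulrC ler_pdivrMr; lra.
lra.
Qed.

(** Self-concordance is applied at [x + t v] and not at [x]: if [x] lies in the
    unit ball around [x + t v], the norm comparison between the two points gives
    the claim; if not, [t * lnorm F (x + t v) v >= 1], which also suffices. This
    gives for every [t] the bound usually got by integrating a differential
    inequality. *)
Lemma lnorm_ray_ge x v t : D x -> K v -> 0 <= t ->
  lnorm F x v <= lnorm F (x + t *: v) v * (1 + t * lnorm F x v).
Proof.
move=> Dx Kv t0; have Du : D (x + t *: v) by apply: DK => //; exact: KZ.
set u := x + t *: v in Du *.
have xu : lnorm F u (x - u) = t * lnorm F u v.
  rewrite /u opprD addrA subrr sub0r.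
  by rewrite -[lnorm F _ _]/(mxnorm _ _) mxnormN mxnormZ ger0_norm.
have h0 : 0 <= lnorm F u v by exact: enorm_ge0.
have p0 : 0 <= lnorm F x v by exact: enorm_ge0.
have [th|th] := ltP (t * lnorm F u v) 1.
  have xb : lball F u u 1 x by rewrite /lball/= xu.
  have := barrier_norm_le FB v Du xb; rewrite xu; clear xu xb.
  by move: (lnorm F u v) (lnorm F x v) h0 p0 th => h p *; lra.
move: (lnorm F u v) (lnorm F x v) h0 p0 th {xu} => h p h0 p0 th.
have : 0 <= (t * h - 1) * p by rewrite mulr_ge0// subr_ge0.
by move=> H; lra.
Qed.

(** Put [p] for the norm of [v] at [x]. By [lnorm_ray_ge] the slope of [F] along
    the ray [x + t v] has derivative at least [p^2 / (1 + p t)^2], whose integral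
    over the half-line is [p]; and the slope never exceeds [0]. *)
Lemma lnorm_le_grad x v : D x -> K v -> lnorm F x v <= - inner v (grad F x).
Proof.
move=> Dx Kv; set p := lnorm F x v.
have p0 : 0 <= p by exact: enorm_ge0.
have Dt t : 0 <= t -> D (x + t *: v) by move=> t0; apply: DK => //; exact: KZ.
have key T : 0 < T -> inner v (grad F x) + p <= p / (1 + p * T).
  move=> T0.
  have := @derive_ge0_le R
    (fun s : R => inner v (grad F (x + s *: v)) + p * (1 + p * s)^-1)
    (fun s => inner v (hess F (x + s *: v) *m v) + p * (- (1 + p * s) ^- 2 * p)) 0 T (ltW T0).
  rewrite scale0r addr0 mulr0 addr0 invr1 mulr1 => H.
  apply: le_trans (H _ _) _.
  - move=> t /[!in_itv]/= /andP[t0 _].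
    have nz : 1 + p * t != 0 by rewrite gt_eqF// ltr_pwDl// mulr_ge0.
    have d0 : is_derive t 1 (fun s : R => 1 + p * s) p.
      have := is_deriveD (@is_derive_cst R R^o R^o 1 t 1) (is_derive_mull p t).
      by rewrite add0r.
    apply: is_deriveD; first exact: (is_derive_grad_line FB v (Dt _ t0)).
    apply: is_deriveZ.
    exact: (@is_deriveV R (fun s : R => 1 + p * s) t p 1 nz d0).
  - move=> t /subset_itv_oo_cc/[!in_itv]/= /andP[t0 _].
    rewrite -(sqr_lnorm FB _ (Dt _ t0)).
    have := lnorm_ray_ge Dx Kv t0; rewrite -/p.
    have : 0 <= lnorm F (x + t *: v) v by exact: enorm_ge0.
    move: (lnorm F (x + t *: v) v) => h h0.
    have q0 : 0 < 1 + p * t by rewrite ltr_pwDl// mulr_ge0.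
    rewrite (mulrC t) -ler_pdivrMr// => ph.
    have : (p / (1 + p * t)) ^+ 2 <= h ^+ 2.
      by rewrite ler_sqr// nnegrE// divr_ge0// ltW.
    rewrite expr_div_n; move: (h ^+ 2) ((1 + p * t) ^- 2) => c d; lra.
  - rewrite gerDr; exact: grad_le0 (Dt _ (ltW T0)) Kv.
rewrite -subr_le0 opprK addrC leNgt; apply/negP => pos.
(* A time T long enough to make the bound p / (1 + p T) less than the sum. *)
have := key (2 / (inner v (grad F x) + p)).
rewrite divr_gt0// => /(_ isT).
set a := inner v (grad F x) + p in pos *.
rewrite leNgt => /negP; apply.
have q0 : 0 < 1 + p * (2 / a) by rewrite ltr_pwDl// mulr_ge0// divr_ge0// ltW.
rewrite ltr_pdivrMr// mulrDr mulr1 mulrCA (mulrCA a) divff ?gt_eqF//.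
by move: (p) (a) p0 pos => r b r0 b0; lra.
Qed.

End BarrierOnCone.

Section DualConeInterior.
Context {R : realType} {n : nat}.
Variables (K D : set 'cV[R]_n) (F : 'cV[R]_n -> R) (nu : R).
Hypothesis FB : barrier_on D F nu.
Hypothesis KZ : forall t x, 0 <= t -> K x -> K (t *: x).
Hypothesis DZ : forall x t, D x -> 0 < t -> D (t *: x).
Hypothesis DK : forall x v, D x -> K v -> D (x + v).
Hypothesis subDK : D `<=` K.
Implicit Types (x s : 'cV[R]_n) (t : R).

(** By [lnorm_le_grad] the dual ball of radius [t] around [- t *: grad F x] lies
    in the dual cone, and this ball is open. *)
Lemma dual_cone_interior x s t : D x ->
  lnormD F x (s + t *: grad F x) < t -> (dual_cone K)° s.
Proof.
move=> Dx st.
have cont := @enorm_mx_continuous R n (invmx (sqrtmx (hess F x))) (t *: grad F x) s.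
have near_s : \forall s' \near s, lnormD F x (s' + t *: grad F x) < t.
  have st' : enorm (invmx (sqrtmx (hess F x)) *m (s + t *: grad F x)) < t by exact: st.
  exact: (cvgr_lt _ cont t st').
apply: filterS near_s => s' s't v Kv /=.
have p0 : 0 <= lnorm F x v by exact: enorm_ge0.
have := inner_le_mxnorm (barrier_pd FB Dx) (- v) (s' + t *: grad F x).
rewrite mxnormN -[mxnorm _ _]/(lnorm F x v) -[mxnormD _ _]/(lnormD F x _).
rewrite innerNl innerDr innerZr.
have := lnorm_le_grad FB KZ DZ DK subDK Dx Kv.
have d0 : 0 <= lnormD F x (s' + t *: grad F x) by exact: enorm_ge0.
move: (lnormD F x _) (lnorm F x v) p0 s't d0 => d p p0 dt d0 h1 h2.
have h3 : d * p <= t * p by rewrite ler_wpM2r// ltW.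
have h4 : t * p <= t * - inner v (grad F x) by rewrite ler_wpM2l// (le_trans d0)// ltW.
lra.
Qed.

(** [nu] is the squared norm of [x], that is, the squared local distance from [x]
    to the origin: if it were below [1], the origin would lie in the unit ball
    around [x], hence in the domain. *)
Lemma barrier_param_ge1 x : D x -> ~ D 0 -> 1 <= nu.
Proof.
move=> Dx; apply: contra_notT; rewrite -ltNge => nu1.
apply: (barrier_ball FB Dx); rewrite /lball/= sub0r.
rewrite -[lnorm _ _ _]/(mxnorm (hess F x) _) mxnormN -[mxnorm _ _]/(lnorm F x x).
by rewrite -(@ltr_sqr R) ?nnegrE ?ler01 ?(sqr_lnorm_self FB Dx) ?expr1n//; exact: enorm_ge0.
Qed.

End DualConeInterior.

(** * One corrector step, for an arbitrary barrier *)

Section CorrectorStep.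
Context {R : realType} {n : nat}.
Variables (D : set 'cV[R]_n) (F : 'cV[R]_n -> R) (nu : R).
Hypothesis FB : barrier_on D F nu.
Variables (x s dx ds : 'cV[R]_n) (mu : R).
Hypothesis Dx : D x.
Hypothesis mu0 : 0 < mu.
Hypothesis nu0 : 0 < nu.
Hypothesis xs : inner x s = mu * nu.
Hypothesis newton : ds + mu *: (hess F x *m dx) = - (s + mu *: grad F x).
Hypothesis ortho : inner dx ds = 0.

Let delta := lnorm F x dx.

Lemma inner_corrector_residual : inner dx (s + mu *: grad F x) = - (mu * delta ^+ 2).
Proof.
rewrite -[s + _]opprK -newton innerNr innerDr ortho add0r innerZr.
by rewrite -(sqr_lnorm FB).
Qed.

(** As [dx] and [ds] are orthogonal, pairing the Newton equation with [dx] gives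
    [mu * delta^2], which is at most [delta] times the dual norm of the
    residual. *)
Lemma corrector_length_le theta :
  lnormD F x (s + mu *: grad F x) <= theta * mu -> delta <= theta.
Proof.
move=> psile; have d0 : 0 <= delta by exact: enorm_ge0.
have := inner_le_mxnorm (barrier_pd FB Dx) (- dx) (s + mu *: grad F x).
rewrite mxnormN innerNl inner_corrector_residual opprK.
rewrite -[mxnorm _ _]/delta -[mxnormD _ _]/(lnormD F x _).
move=> h; have {}h : mu * delta ^+ 2 <= delta * (theta * mu).
  by apply: le_trans h _; rewrite ler_wpM2l.
have := enorm_ge0 (invmx (sqrtmx (hess F x)) *m (s + mu *: grad F x)).
move=> /le_trans/(_ psile); rewrite pmulr_lge0// => theta0.
have {}h : delta * delta <= theta * delta.
  by move: h mu0 => h m0; rewrite -(ler_pM2l mu0); lra.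
by move: d0; rewrite le_eqVlt => /orP[/eqP <-//|d0]; rewrite -(ler_pM2r d0).
Qed.

(** Homogeneity makes the residual orthogonal to [x], so that the gap changes
    only through the pairing of [dx] with the residual. *)
Lemma corrector_gap : inner (x + dx) (s + ds) = mu * (nu - delta ^+ 2).
Proof.
have E : inner x ds = mu * inner dx (grad F x).
  have -> : ds = - (s + mu *: grad F x) - mu *: (hess F x *m dx) by rewrite -newton addrK.
  rewrite innerBr innerNr innerDr !innerZr xs innerC (inner_grad FB Dx) => //.
  have -> : inner x (hess F x *m dx) = - inner dx (grad F x).
    rewrite -{1}(barrier_pd FB Dx).1 innerC inner_mxl (hess_mul_self FB Dx).
    by rewrite innerNr.
  ring.
have := inner_corrector_residual.
rewrite !(innerDl, innerDr) innerZr ortho xs E; lra.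
Qed.

(** The Newton equation turns the new residual into
    [mu] times the Taylor remainder of the gradient minus [mu * delta^2 / nu]
    times the new gradient. The first term is bounded by [grad_taylor_le] and by
    the comparison of norms between [x] and [x + dx]; the new gradient has dual
    norm [sqrt nu]. *)
Lemma corrector_residual_le : delta < 1 ->
  let mu' := inner (x + dx) (s + ds) / nu in
  lnormD F (x + dx) (s + ds + mu' *: grad F (x + dx)) <=
    mu * (delta ^+ 2 / (1 - delta) ^+ 2 + delta ^+ 2 / Num.sqrt nu).
Proof.
move=> d1 /=; rewrite corrector_gap.
have d0 : 0 <= delta by exact: enorm_ge0.
have q0 : 0 < 1 - delta by rewrite subr_gt0.
have e : x + dx - x = dx by rewrite addrC addKr.
have xb : lball F x x 1 (x + dx) by rewrite /lball/= e.
have Dx' : D (x + dx) by exact: (barrier_ball FB Dx).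
set r := Num.sqrt nu; have r0 : 0 < r by rewrite sqrtr_gt0.
have rE : nu = r ^+ 2 by rewrite sqr_sqrtr// ltW.
have g'E : lnormD F (x + dx) (grad F (x + dx)) = r.
  apply/eqP; rewrite -(@eqrXn2 _ 2)//; last 2 first.
  - exact: enorm_ge0.
  - exact: ltW.
  by rewrite (sqr_lnormD_grad FB Dx') rE.
have sds : s + ds = - (mu *: grad F x) - mu *: (hess F x *m dx).
  by rewrite -[ds](addrK (mu *: (hess F x *m dx))) newton opprD addrA addrA subrr sub0r.
apply: (mxnormD_le (barrier_pd FB Dx')) => [|w].
  by rewrite mulr_ge0 ?(ltW mu0)// addr_ge0// divr_ge0 ?sqr_ge0 ?(ltW r0).
have -> : s + ds + (mu * (nu - delta ^+ 2) / nu) *: grad F (x + dx) =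
    mu *: (grad F (x + dx) - grad F x - hess F x *m dx)
    - (mu * (delta ^+ 2 / nu)) *: grad F (x + dx).
  have -> : mu * (nu - delta ^+ 2) / nu = mu - mu * (delta ^+ 2 / nu).
    by field; rewrite gt_eqF.
  by rewrite sds scalerBl !scalerBr addrA; congr (_ - _); rewrite addrC addrA.
rewrite innerBr !innerZr.
have taylor := grad_taylor_le FB w Dx d1; rewrite -/delta in taylor.
have wle := barrier_norm_ge FB w Dx xb; rewrite e -/delta in wle.
have gle := inner_le_mxnorm (barrier_pd FB Dx') (- w) (grad F (x + dx)).
rewrite mxnormN innerNl -[mxnormD _ _]/(lnormD F _ _) g'E in gle.
rewrite -[mxnorm _ w]/(lnorm F (x + dx) w) in gle *.
move: (inner w _) (inner w _) (lnorm F x w) (lnorm F (x + dx) w) taylor wle gle.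
move=> G T p p' taylor wle gle.
have -> : delta ^+ 2 / nu = delta ^+ 2 / r / r by rewrite rE; field; rewrite gt_eqF.
rewrite -[leRHS]mulrA [leLHS](_ : _ = mu * (T + delta ^+ 2 / r / r * - G)); last by ring.
rewrite ler_pM2l//.
have h1 : T <= delta ^+ 2 / (1 - delta) ^+ 2 * p'.
  apply: le_trans taylor _.
  have -> : delta ^+ 2 / (1 - delta) = delta ^+ 2 / (1 - delta) ^+ 2 * (1 - delta).
    by field; rewrite gt_eqF.
  by rewrite -mulrA ler_wpM2l// divr_ge0 ?sqr_ge0.
have h2 : delta ^+ 2 / r / r * - G <= delta ^+ 2 / r * p'.
  rewrite -[leLHS]mulrA ler_wpM2l ?divr_ge0 ?sqr_ge0 ?(ltW r0)//.
  by rewrite mulrC ler_pdivrMr.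
lra.
Qed.

End CorrectorStep.

(** * The extended barrier is a barrier *)

Section ExtendedBarrier.
Context {R : realType} {n : nat}.
Implicit Types (x v a b : 'cV[R]_(n + 1)).

(** The coordinate tau of the extended point (x; tau). *)
Definition homog x : R := dsubmx x 0 0.

Lemma inner_split a b :
  inner a b = inner (usubmx a) (usubmx b) + homog a * homog b.
Proof.
rewrite -{1}[a]vsubmxK -{1}[b]vsubmxK inner_col_mx; congr (_ + _).
by rewrite innerE big_ord1.
Qed.

Lemma homogE x : dsubmx x = (homog x)%:M.
Proof. exact: mx11_scalar. Qed.

Lemma col_mx_homogK (u : 'cV[R]_n) (t : R) : homog (col_mx u t%:M) = t.
Proof. by rewrite /homog col_mxKd mxE eqxx. Qed.

Lemma homogD a b : homog (a + b) = homog a + homog b.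
Proof. by rewrite /homog linearD mxE. Qed.

Lemma homogZ (t : R) a : homog (t *: a) = t * homog a.
Proof. by rewrite /homog linearZ mxE. Qed.

Lemma homogB a b : homog (a - b) = homog a - homog b.
Proof. by rewrite /homog linearB !mxE. Qed.

Lemma is_derive_dir (f : R -> R) (x w d : R) :
  is_derive x 1 f d -> is_derive x w f (w * d).
Proof.
move=> fd; have df : differentiable f x by apply/derivable1_diffP.
split; first exact: diff_derivable.
rewrite deriveE// -[w in LHS]mulr1 -[w * 1]/(w *: (1 : R^o)) linearZ/= -deriveE//.
by have [_ ->] := fd.
Qed.

Lemma grad_eq (m : nat) (f : 'cV[R]_m -> R) (x g : 'cV[R]_m) :
  (forall v : 'cV[R]_m, is_derive x v f (inner g v)) -> grad f x = g.
Proof.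
move=> fg; apply/colP => i; rewrite mxE; have [_ ->] := fg (delta_mx i 0).
rewrite innerE (bigD1 i)//= mxE !eqxx mulr1 big1 ?addr0// => j ji.
by rewrite mxE (negbTE ji) mulr0.
Qed.

Variables (D : set 'cV[R]_n) (F : 'cV[R]_n -> R) (nu : R).
Hypothesis FB : barrier_on D F nu.

Definition ext_domain : set 'cV[R]_(n + 1) :=
  [set x | D (usubmx x) /\ 0 < homog x].

Definition ext_grad x : 'cV[R]_(n + 1) :=
  col_mx (grad F (usubmx x)) (- (homog x)^-1)%:M.

Definition ext_hess x : 'M[R]_(n + 1) :=
  block_mx (hess F (usubmx x)) 0 0 ((homog x) ^- 2)%:M.

Lemma usubmx_continuous : continuous (fun x : 'cV[R]_(n + 1) => usubmx x).
Proof.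
move=> x A /= /nbhs_ballP[e e0 eA]; apply/nbhs_ballP; exists e => // y [e0' xy].
by apply: eA; split=> // i j; rewrite !mxE; exact: xy.
Qed.

Lemma homog_continuous : continuous homog.
Proof.
have -> : homog = fun x : 'cV[R]_(n + 1) => x (rshift n 0) 0.
  by apply: funext => x; rewrite /homog mxE.
exact: coord_continuous.
Qed.

Lemma ext_domain_open : open D -> open ext_domain.
Proof.
move=> Dopen.
have o1 : open ((fun x : 'cV[R]_(n + 1) => usubmx x) @^-1` D).
  apply: open_comp Dopen => x _; exact: usubmx_continuous.
have o2 : open (homog @^-1` [set t : R | 0 < t]).
  by apply: open_comp (@open_gt R 0) => x _; exact: homog_continuous.
exact: (openI o1 o2).
Qed.

Lemma is_derive_ext x v : ext_domain x ->
  is_derive x v (ext_barrier F) (inner (ext_grad x) v).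
Proof.
move=> [Dx x0]; rewrite inner_split /ext_grad col_mxKu col_mx_homogK mulNr.
apply: is_deriveB.
  apply: (@is_derive_affine _ _ _ R^o F (fun y => usubmx y) x v (usubmx v)).
    by move=> h; rewrite linearD linearZ.
  exact: (barrier_grad FB).
apply: (@is_derive_affine _ _ R^o R^o (@ln R) homog x v (homog v)).
  by move=> h; rewrite homogD homogZ.
by rewrite mulrC; apply: is_derive_dir; exact: is_derive1_ln.
Qed.

Lemma grad_ext x : ext_domain x -> grad (ext_barrier F) x = ext_grad x.
Proof. by move=> Dx; apply: grad_eq => v; exact: is_derive_ext. Qed.

Lemma ext_hess_mul x v : ext_hess x *m v =
  col_mx (hess F (usubmx x) *m usubmx v) ((homog x) ^- 2 * homog v)%:M.
Proof.
rewrite -{1}[v]vsubmxK mul_block_col !mul0mx addr0 add0r homogE.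
by rewrite -scalar_mxM.
Qed.

Lemma is_derive_ext_grad x v i : ext_domain x ->
  is_derive x v (fun y => grad (ext_barrier F) y i 0) ((ext_hess x *m v) i 0).
Proof.
move=> Dx; have near_x : \forall y \near x, ext_grad y i 0 = grad (ext_barrier F) y i 0.
  have := open_nbhs_nbhs (conj (ext_domain_open (barrier_open FB)) Dx).
  by apply: filterS => y Dy; rewrite grad_ext.
apply: (near_eq_is_derive near_x); move: Dx => [Dx x0] {near_x}.
rewrite ext_hess_mul -(splitK i); case: (fintype.split i) => j /=.
  rewrite col_mxEu.
  have -> : (fun y => ext_grad y (lshift 1 j) 0) =
      (fun u => grad F u j 0) \o (fun y => usubmx y).
    by apply: funext => y; rewrite /ext_grad/= col_mxEu.
  apply: (@is_derive_affine _ _ _ R^o _ _ x v (usubmx v)).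
    by move=> h; rewrite linearD linearZ.
  exact: (barrier_hess FB).
rewrite col_mxEd !ord1 mxE eqxx mulr1n.
have -> : (fun y => ext_grad y (rshift n 0) 0) = (fun t : R => - t^-1) \o homog.
  by apply: funext => y; rewrite /ext_grad/= col_mxEd mxE eqxx.
apply: (@is_derive_affine _ _ R^o R^o _ _ x v (homog v)).
  by move=> h; rewrite homogD homogZ.
rewrite mulrC; apply: is_derive_dir.
have nz : homog x != 0 by rewrite gt_eqF.
have := is_deriveN (@is_deriveV R id (homog x) 1 1 nz (is_derive_id _ _)).
by rewrite scaleNr opprK [_%:A]mulr1.
Qed.

Lemma hess_ext x : ext_domain x -> hess (ext_barrier F) x = ext_hess x.
Proof.
move=> Dx; apply/matrixP => i j; rewrite mxE.
have [_ ->] := is_derive_ext_grad (delta_mx j 0) i Dx.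
by rewrite -colE [LHS]mxE.
Qed.

Lemma inner_ext_hess x a b : inner a (ext_hess x *m b) =
  inner (usubmx a) (hess F (usubmx x) *m usubmx b) + (homog x) ^- 2 * (homog a * homog b).
Proof. by rewrite inner_split ext_hess_mul col_mxKu col_mx_homogK mulrCA. Qed.

Lemma pdmx_ext x : ext_domain x -> pdmx (hess (ext_barrier F) x).
Proof.
move=> Dx; rewrite (hess_ext Dx); move: Dx => [Dx x0].
have [Hsym Hpos] := barrier_pd FB Dx.
split; first by rewrite /ext_hess tr_block_mx !trmx0 tr_scalar_mx Hsym.
move=> v v0; rewrite inner_ext_hess.
have c0 : 0 < (homog x) ^- 2 by rewrite invr_gt0 exprn_gt0.
have [u0|u0] := eqVneq (usubmx v) 0; last first.
  by rewrite ltr_pwDl ?Hpos// mulr_ge0 ?(ltW c0)// -expr2 sqr_ge0.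
rewrite u0 inner0l add0r mulr_gt0// lt_def -expr2 sqr_ge0 andbT sqrf_eq0.
apply: contraNneq v0 => h0.
by rewrite -[v]vsubmxK u0 homogE h0 raddf0 col_mx0.
Qed.

Lemma sqr_lnorm_ext x v : ext_domain x ->
  lnorm (ext_barrier F) x v ^+ 2 =
    lnorm F (usubmx x) (usubmx v) ^+ 2 + (`|homog v| / homog x) ^+ 2.
Proof.
move=> Dx; rewrite -[lnorm (ext_barrier F) _ _]/(mxnorm (hess (ext_barrier F) x) _).
rewrite (sqr_mxnorm (pdmx_ext Dx)) (hess_ext Dx) inner_ext_hess.
rewrite (sqr_lnorm FB _ Dx.1); congr (_ + _).
by rewrite expr_div_n real_normK ?num_real// expr2 mulrC.
Qed.

(** Used to combine the comparison of norms in the factor x with the one in the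
    factor tau, the extended norm being the Euclidean norm of the pair. *)
Lemma ext_norm_le_sqr (a q1 q2 p1 p2 q p : R) : 0 <= a -> 0 <= q1 -> 0 <= q2 ->
  0 <= q -> 0 <= p -> a * q1 <= p1 -> a * q2 <= p2 ->
  q ^+ 2 = q1 ^+ 2 + q2 ^+ 2 -> p ^+ 2 = p1 ^+ 2 + p2 ^+ 2 -> a * q <= p.
Proof.
move=> a0 q10 q20 q0 p0 le1 le2 qE pE.
rewrite -ler_sqr ?nnegrE ?mulr_ge0// exprMn qE pE mulrDr -!exprMn.
have pos1 := le_trans (mulr_ge0 a0 q10) le1.
have pos2 := le_trans (mulr_ge0 a0 q20) le2.
by apply: lerD; rewrite ler_sqr ?nnegrE ?mulr_ge0.
Qed.

Lemma lnorm_ext_ge x v : ext_domain x ->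
  lnorm F (usubmx x) (usubmx v) <= lnorm (ext_barrier F) x v /\
  `|homog v| / homog x <= lnorm (ext_barrier F) x v.
Proof.
move=> Dx; have := sqr_lnorm_ext v Dx.
have : 0 <= lnorm (ext_barrier F) x v by exact: enorm_ge0.
have : 0 <= lnorm F (usubmx x) (usubmx v) by exact: enorm_ge0.
have : 0 <= `|homog v| / homog x by rewrite divr_ge0 ?(ltW Dx.2).
move: (lnorm F _ _) (lnorm (ext_barrier F) _ _) (`|_| / _) => p q t t0 p0 q0 qE.
by split; rewrite -ler_sqr ?nnegrE// qE ?lerDl ?lerDr sqr_ge0.
Qed.

(** Self-concordance of [- ln] on the positive half-line. *)
Lemma ext_homog_bounds x u : ext_domain x -> lball (ext_barrier F) x x 1 u ->
  let r := lnorm (ext_barrier F) x (u - x) in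
  (1 - r) * homog x <= homog u /\ (1 - r) * homog u <= homog x.
Proof.
move=> Dx; rewrite /lball/= => r1.
have := (lnorm_ext_ge (u - x) Dx).2; rewrite homogB.
have : 0 <= lnorm (ext_barrier F) x (u - x) by exact: enorm_ge0.
move: (lnorm (ext_barrier F) _ _) r1 => r r1 r0; have x0 := Dx.2.
rewrite ler_pdivrMr// ler_norml => /andP[lo hi].
split; first lra.
have : (1 - r) * homog u <= (1 - r) * ((1 + r) * homog x).
  by rewrite ler_pM2l ?subr_gt0//; lra.
have : 0 <= r ^+ 2 * homog x by rewrite mulr_ge0 ?sqr_ge0// ltW.
lra.
Qed.

Lemma ext_ball x : ext_domain x -> lball (ext_barrier F) x x 1 `<=` ext_domain.
Proof.
move=> Dx u ux; split.
  apply: (barrier_ball FB Dx.1); rewrite /lball/= -linearB/=.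
  exact: le_lt_trans (lnorm_ext_ge (u - x) Dx).1 ux.
apply: lt_le_trans (ext_homog_bounds Dx ux).1.
by rewrite mulr_gt0 ?subr_gt0 ?Dx.2.
Qed.

Lemma ext_barrier_on : barrier_on ext_domain (ext_barrier F) (nu + 1).
Proof.
have small x u : ext_domain x -> lball (ext_barrier F) x x 1 u ->
    lball F (usubmx x) (usubmx x) 1 (usubmx u) /\
    lnorm F (usubmx x) (usubmx u - usubmx x) <= lnorm (ext_barrier F) x (u - x).
  move=> Dx ux; have := (lnorm_ext_ge (u - x) Dx).1; rewrite linearB/= => le.
  by split=> //; exact: le_lt_trans le ux.
have lpos (G : 'cV[R]_(n + 1) -> R) (x v : 'cV[R]_(n + 1)) : 0 <= lnorm G x v by exact: enorm_ge0.
have lpos' (x v : 'cV[R]_n) : 0 <= lnorm F x v by exact: enorm_ge0.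
split.
- exact: ext_domain_open (barrier_open FB).
- by move=> x v Dx; rewrite (grad_ext Dx); exact: is_derive_ext.
- by move=> x v i Dx; rewrite (hess_ext Dx); exact: is_derive_ext_grad.
- exact: pdmx_ext.
- exact: ext_ball.
- move=> x u v Dx ux; have Du := ext_ball Dx ux.
  have [uxF rle] := small x u Dx ux.
  have r1 : 0 <= 1 - lnorm (ext_barrier F) x (u - x) by rewrite subr_ge0; exact: ltW.
  apply: (ext_norm_le_sqr r1 (lpos' _ _) _ (lpos _ _ _) (lpos _ _ _) _ _
           (sqr_lnorm_ext v Dx) (sqr_lnorm_ext v Du)).
  + by rewrite divr_ge0 ?(ltW Dx.2).
  + apply: le_trans (barrier_norm_ge FB (usubmx v) Dx.1 uxF).
    by rewrite ler_wpM2r ?lpos'// lerD2l lerN2.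
  + rewrite mulrCA ler_wpM2l// -[leRHS]div1r ler_pdivlMr ?Du.2// mulrAC ler_pdivrMr ?Dx.2//.
    by rewrite mul1r; exact: (ext_homog_bounds Dx ux).2.
- move=> x u v Dx ux; have Du := ext_ball Dx ux.
  have [uxF rle] := small x u Dx ux.
  have r1 : 0 <= 1 - lnorm (ext_barrier F) x (u - x) by rewrite subr_ge0; exact: ltW.
  apply: (ext_norm_le_sqr r1 (lpos' _ _) _ (lpos _ _ _) (lpos _ _ _) _ _
           (sqr_lnorm_ext v Du) (sqr_lnorm_ext v Dx)).
  + by rewrite divr_ge0 ?(ltW Du.2).
  + apply: le_trans (barrier_norm_le FB (usubmx v) Dx.1 uxF).
    by rewrite ler_wpM2r ?lpos'// lerD2l lerN2.
  + rewrite mulrCA ler_wpM2l// -[leRHS]div1r ler_pdivlMr ?Dx.2// mulrAC ler_pdivrMr ?Du.2//.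
    by rewrite mul1r; exact: (ext_homog_bounds Dx ux).1.
- move=> x t Dx t0; rewrite /ext_barrier -!/(homog _) homogZ linearZ/=.
  rewrite (barrier_hom FB Dx.1 t0) lnM ?posrE ?Dx.2//.
  by rewrite mulrDl mul1r; ring.
Qed.

End ExtendedBarrier.

(** * Cones and their interiors *)

Section ConeInterior.
Context {R : realType} {n : nat}.
Variable K : set 'cV[R]_n.
Hypothesis KZ : forall t x, 0 <= t -> K x -> K (t *: x).
Hypothesis KD : forall x y, K x -> K y -> K (x + y).
Implicit Types (x v : 'cV[R]_n) (t : R).

Lemma cone_interiorD x v : K° x -> K v -> K° (x + v).
Proof.
move=> Kx Kv.
have : y - v @[y --> x + v] --> x + v - v.
  by exact: (cvgB cvg_id (cvg_cst v)).
rewrite addrK => /(_ _ Kx) Kv'.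
apply: (@filterS _ (nbhs (x + v)) _ [set y | K (y - v)] _ _ Kv') => y /= Ky.
by rewrite -(subrK v y); exact: KD.
Qed.

Lemma cone_interiorZ x t : K° x -> 0 < t -> K° (t *: x).
Proof.
move=> Kx t0.
have : t^-1 *: y @[y --> t *: x] --> t^-1 *: (t *: x).
  exact: (cvgZ (cvg_cst t^-1) cvg_id).
rewrite scalerA mulVf ?gt_eqF// scale1r => /(_ _ Kx) Kt.
apply: (@filterS _ (nbhs (t *: x)) _ [set y | K (t^-1 *: y)] _ _ Kt) => y /= Ky.
by rewrite -(scale1r y) -(mulfV (lt0r_neq0 t0)) -scalerA; apply: KZ => //; exact: ltW.
Qed.

End ConeInterior.

Section ConeTopology.
Context {R : realType}.

Lemma interior_ext_cone (n : nat) (K : set 'cV[R]_n) :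
  (ext_cone K)° = ext_domain K°.
Proof.
apply/seteqP; split=> [x /nbhs_ballP[e e0 xe]|x]; last first.
  move=> Dx; have Dop : open (ext_domain K°) by apply: ext_domain_open; exact: open_interior.
  apply: filterS (open_nbhs_nbhs (conj Dop Dx)) => y [Ky y0].
  by split; [exact: interior_subset Ky|exact: ltW].
split.
  apply/nbhs_ballP; exists e => // u [_ xu].
  suff /xe[] : ball x e (col_mx u (dsubmx x)) by rewrite col_mxKu.
  split=> // i j; rewrite -(splitK i); case: (fintype.split i) => k /=.
    by rewrite col_mxEu; have := xu k j; rewrite mxE.
  by rewrite col_mxEd mxE; exact: ballxx.
have e2 : 0 < e / 2 by rewrite divr_gt0.
(* Lowering tau by e / 2 stays in the cone, so tau itself is positive. *)
suff /xe[_] : ball x e (col_mx (usubmx x) (homog x - e / 2)%:M).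
  by rewrite -/(homog _) col_mx_homogK subr_ge0; exact: lt_le_trans.
split=> // i j; rewrite -(splitK i) ord1; case: (fintype.split i) => k /=.
  by rewrite col_mxEu mxE; exact: ballxx.
rewrite col_mxEd ord1 mxE eqxx mulr1n.
have -> : x (rshift n 0) 0 = homog x by rewrite /homog mxE.
rewrite /ball/= opprB addrC subrK gtr0_norm//.
by rewrite ltr_pdivrMr// ltr_pMr// ltr1n.
Qed.

Lemma dual_ext_cone (n : nat) (K : set 'cV[R]_n) : K 0 ->
  dual_cone (ext_cone K) `<=` ext_cone (dual_cone K).
Proof.
move=> K0 s sK; split.
  move=> x Kx; have := sK (col_mx x 0%:M); rewrite inner_split col_mxKu col_mx_homogK mul0r addr0.
  by apply; split; rewrite ?col_mxKu// -/(homog _) col_mx_homogK.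
have := sK (col_mx 0 1%:M); rewrite inner_split col_mxKu col_mx_homogK inner0l add0r mul1r.
by apply; split; rewrite ?col_mxKu// -/(homog _) col_mx_homogK.
Qed.

Lemma interior_calF (n m : nat) (K : set 'cV[R]_n) (z : pd_point R n m) :
  (calF K)° z <->
  (ext_cone K)° (xbar z) /\ (ext_cone (dual_cone K))° (sbar z).
Proof.
case: z => [[x y] s]; split=> [[[P Q] [/= Pn Qn] PQ]|[Kx Ks]].
  case: Pn => -[X Y] [/= Xx Yy] XY.
  have Py u : X u -> P (u, y) by move=> Xu; apply: XY; split=> //=; exact: nbhs_singleton.
  split; first apply: filterS Xx => u Xu.
    by case: (PQ ((u, y), s)) => //; split=> /=; [exact: Py|exact: nbhs_singleton].
  apply: filterS Qn => u Qu.
  by case: (PQ ((x, y), u)) => //; split=> //=; apply: Py; exact: nbhs_singleton.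
exists ([set w | ext_cone K w.1], ext_cone (dual_cone K)); last by move=> [[u v] t] [].
split=> //=; exists (ext_cone K, setT); last by move=> [u v] [].
by split=> //=; exact: filterT.
Qed.

(** A neighbourhood of the origin contains a small constant vector together with
    its opposite. *)
Lemma pointed_interior (n : nat) (K : set 'cV[R]_n) :
  (forall x, K x -> K (- x) -> x = 0) -> K° 0 -> n = 0%N.
Proof.
case: n K => // n K pointed /nbhs_ballP[e e0 eK].
have e2 : 0 < e / 2 by rewrite divr_gt0.
have small (a : R) : `|a| = e / 2 -> K (const_mx a).
  move=> ae; apply: eK; split=> // i j; rewrite !mxE /ball/= sub0r normrN ae.
  by rewrite ltr_pdivrMr// ltr_pMr// ltr1n.
have : const_mx (e / 2) = 0 :> 'cV[R]_n.+1.
  apply: pointed; first by apply: small; exact: gtr0_norm.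
  have -> : - const_mx (e / 2) = const_mx (- (e / 2)) :> 'cV[R]_n.+1.
    by apply/matrixP => i j; rewrite !mxE.
  by apply: small; rewrite normrN gtr0_norm.
by move=> /matrixP/(_ 0 0); rewrite !mxE => e20; move: e2; rewrite e20 ltxx.
Qed.

Lemma proper_coneD (n : nat) (K : set 'cV[R]_n) : proper_cone K ->
  forall x y, K x -> K y -> K (x + y).
Proof.
move=> [KZ _ Kconv _ _] x y Kx Ky.
have l0 : 0 <= (2^-1 : R) by rewrite invr_ge0 ler0n.
have l1 : (2^-1 : R) <= 1 by rewrite invf_le1// ler1n.
have := Kconv x y (Itv01 l0 l1) (mem_set Kx) (mem_set Ky).
move=> /set_mem Kxy.
have : K (2^-1 *: x + (1 - 2^-1) *: y) by exact: Kxy.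
move=> /(KZ 2 _ (ler0n _ 2)); rewrite scalerDr !scalerA divff ?pnatr_eq0// scale1r.
by have -> : 2 * (1 - 2^-1) = 1 :> R; [field|rewrite scale1r].
Qed.

End ConeTopology.

(** * Solvability of the corrector system *)

Section LinearSystem.
Context {R : realType} {n m : nat}.
Variables (A : 'M[R]_(m, n)) (b : 'cV[R]_m) (c : 'cV[R]_n).

Lemma Gmx_skew : (Gmx A b c)^T = - Gmx A b c.
Proof.
rewrite /Gmx !tr_block_mx tr_row_mx tr_col_mx !trmx0 !linearN/= !trmxK.
rewrite !opp_block_mx opp_row_mx opp_col_mx !oppr0 !opprK.
by [].
Qed.

Lemma inner_skew (p : nat) (G : 'M[R]_p) w : G^T = - G -> inner w (G *m w) = 0.
Proof.
move=> Gs; have : inner w (G *m w) = - inner w (G *m w).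
  by rewrite -[LHS]inner_mxl Gs mulNmx innerNl innerC.
by move: (inner _ _) => t; lra.
Qed.

Lemma unitmx_ker0 (p : nat) (N : 'M[R]_p) :
  (forall w : 'cV[R]_p, N *m w = 0 -> w = 0) -> N \in unitmx.
Proof.
move=> N0; rewrite -unitmx_tr -row_free_unit -kermx_eq0.
apply/negPn/negP => /rowV0Pn[v /sub_kermxP vN v0].
move: v0; rewrite -(inj_eq (can_inj (@trmxK _ _ _))) (N0 v^T) ?trmx0 ?eqxx//.
by apply: (can_inj (@trmxK _ _ _)); rewrite trmx_mul trmxK vN trmx0.
Qed.

Variables (H : 'M[R]_(n + 1)) (mu : R).
Hypothesis Hpd : pdmx H.
Hypothesis mu0 : 0 < mu.
Hypothesis Afree : row_free A.

(** The matrix of the corrector system in (y; x) once s has been eliminated. *)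
Definition corrector_mx : 'M[R]_(m + (n + 1)) :=
  Gmx A b c +
  mu *: block_mx (0 : 'M[R]_m) (0 : 'M[R]_(m, n + 1)) (0 : 'M[R]_(n + 1, m)) H.

Lemma corrector_mx_mul (y : 'cV[R]_m) (x : 'cV[R]_(n + 1)) :
  corrector_mx *m col_mx y x =
  Gmx A b c *m col_mx y x + col_mx 0 (mu *: (H *m x)).
Proof.
rewrite mulmxDl -scalemxAl; congr (_ + _); rewrite mul_block_col !mul0mx !add0r.
by rewrite scale_col_mx scaler0.
Qed.

(** The quadratic form of [corrector_mx] only sees [H], as [Gmx] is skew; so a
    kernel vector has no x-part, and then its y-part is a vanishing combination
    of the rows of [A], which are free. *)
Lemma corrector_mx_unit : corrector_mx \in unitmx.
Proof.
apply: unitmx_ker0 => w; rewrite -[w]vsubmxK.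
move: (usubmx w) (dsubmx w) => y x; rewrite corrector_mx_mul => NW.
have x0 : x = 0.
  have := congr1 (inner (col_mx y x)) NW.
  rewrite innerDr (inner_skew _ Gmx_skew) add0r inner_col_mx !inner0r add0r innerZr.
  move=> /eqP; rewrite mulf_eq0 gt_eqF//=.
  by apply: contraTeq => x0; rewrite gt_eqF//; exact: Hpd.2.
move: NW; rewrite x0 mulmx0 scaler0 col_mx0 addr0 /Gmx mul_block_col !mulmx0 !addr0.
rewrite mul0mx mul_col_mx => /eqP.
rewrite !col_mx_eq0 mulNmx oppr_eq0 => /andP[_ /andP[/eqP Ay _]].
suff -> : y = 0 by rewrite col_mx0.
apply/eqP; rewrite -(inj_eq (can_inj (@trmxK _ _ _))) trmx0.
by rewrite -(mulmx_free_eq0 _ Afree) -[A]trmxK -trmx_mul Ay trmx0.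
Qed.

End LinearSystem.

(** * The corrector phase *)

(** The numerical condition under which one step takes the neighbourhood of
    radius [beta] into that of radius [theta]. The constants [3 / 4] and [1 / 2]
    bound [1 / sqrt N] and [1 / N] for the parameter [N >= 2] of the extended
    barrier. *)
Definition contracts {R : realType} (beta theta : R) : Prop :=
  [/\ 0 <= beta < 1, 0 <= theta < 1 &
      beta ^+ 2 / (1 - beta) ^+ 2 + beta ^+ 2 * (3 / 4 + theta / 2) <= theta].

Lemma contractsI (R : realType) (beta theta : R) :
  0 <= beta -> beta < 1 -> 0 <= theta -> theta < 1 ->
  beta ^+ 2 <= (theta - beta ^+ 2 * (3 / 4 + theta / 2)) * (1 - beta) ^+ 2 ->
  contracts beta theta.
Proof.
move=> b0 b1 t0 t1 h; split; [exact/andP|exact/andP|].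
by rewrite -lerBrDr ler_pdivrMr// exprn_gt0// subr_gt0.
Qed.

Lemma contracts_bound (R : realType) (beta theta delta N : R) :
  contracts beta theta -> 0 <= delta <= beta -> 2 <= N ->
  delta ^+ 2 / (1 - delta) ^+ 2 + delta ^+ 2 / Num.sqrt N <=
    theta * (1 - delta ^+ 2 / N).
Proof.
move=> [/andP[b0 b1] /andP[t0 t1] bt] /andP[d0 db] N2.
have d1 : delta < 1 by exact: le_lt_trans b1.
have N0 : 0 < N by exact: lt_le_trans N2.
have sqN : 4 / 3 <= Num.sqrt N.
  have -> : 4 / 3 = Num.sqrt ((4 / 3) ^+ 2) :> R by rewrite sqrtr_sqr gtr0_norm.
  by rewrite ler_sqrt// (le_trans _ N2)//; lra.
have dd : delta ^+ 2 <= beta ^+ 2 by rewrite ler_sqr ?nnegrE.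
have h1 : delta ^+ 2 / (1 - delta) ^+ 2 <= beta ^+ 2 / (1 - beta) ^+ 2.
  apply: ler_pM => //; rewrite ?sqr_ge0 ?invr_ge0 ?sqr_ge0//.
  rewrite lef_pV2 ?posrE ?exprn_gt0 ?subr_gt0//.
  by rewrite ler_sqr ?nnegrE ?subr_ge0 ?(ltW b1) ?(ltW d1)// lerD2l lerN2.
have h2 : delta ^+ 2 / Num.sqrt N <= beta ^+ 2 * (3 / 4).
  apply: ler_pM => //; rewrite ?sqr_ge0 ?invr_ge0 ?sqrtr_ge0//.
  have -> : 3 / 4 = (4 / 3)^-1 :> R by field.
  by rewrite lef_pV2 ?posrE ?(lt_le_trans _ sqN).
have h3 : delta ^+ 2 / N <= beta ^+ 2 * 2^-1.
  by apply: ler_pM => //; rewrite ?sqr_ge0 ?invr_ge0 ?(ltW N0)// lef_pV2 ?posrE.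
have h4 : theta * (delta ^+ 2 / N) <= theta * (beta ^+ 2 * 2^-1) by rewrite ler_wpM2l.
rewrite mulrBr mulr1; move: h1 h2 h4 bt.
move: (delta ^+ 2 / (1 - delta) ^+ 2) (delta ^+ 2 / Num.sqrt N) (theta * (delta ^+ 2 / N)).
by move: (beta ^+ 2 / (1 - beta) ^+ 2) => a1 a2 a3 a4; lra.
Qed.

(** Covers the degenerate case of a cone in dimension zero, where the parameter
    of the extended barrier need not reach [2]: the residual, being orthogonal
    to the extended point, vanishes. *)
Lemma col1_orthogonal (R : realType) (n : nat) (x p : 'cV[R]_(n + 1)) :
  n = 0%N -> homog x != 0 -> inner x p = 0 -> p = 0.
Proof.
move=> n0; subst n; rewrite inner_split.
have -> : usubmx p = 0 by exact: flatmx0.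
rewrite inner0r add0r => x0 /eqP; rewrite mulf_eq0 (negbTE x0)/= => /eqP p0.
by rewrite -[p]vsubmxK homogE p0 raddf0 [usubmx p]flatmx0 col_mx0.
Qed.

Section Corrector.
Context {R : realType} {n m : nat}.
Variables (K : set 'cV[R]_n) (F : 'cV[R]_n -> R) (nu : R).
Variables (A : 'M[R]_(m, n)) (b : 'cV[R]_m) (c : 'cV[R]_n).
Hypothesis hK : proper_cone K.
Hypothesis hF : log_hom_barrier K F nu.
Hypothesis hA : row_free A.
Implicit Types z : pd_point R n m.

Local Notation Dext := (ext_domain K°).

Lemma ext_coneZ t (x : 'cV[R]_(n + 1)) : 0 <= t -> ext_cone K x -> ext_cone K (t *: x).
Proof.
have [KZ _ _ _ _] := hK; move=> t0 [Kx x0]; split; first by rewrite linearZ; exact: KZ.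
by rewrite -/(homog _) homogZ mulr_ge0.
Qed.

Lemma ext_domainZ (x : 'cV[R]_(n + 1)) t : Dext x -> 0 < t -> Dext (t *: x).
Proof.
have [KZ _ _ _ _] := hK; move=> [Dx x0] t0; split.
  by rewrite linearZ; exact: cone_interiorZ.
by rewrite homogZ mulr_gt0.
Qed.

Lemma ext_domainD (x v : 'cV[R]_(n + 1)) : Dext x -> ext_cone K v -> Dext (x + v).
Proof.
move=> [Dx x0] [Kv v0]; split.
  by rewrite linearD; apply: cone_interiorD => //; exact: proper_coneD.
by rewrite homogD ltr_pwDl.
Qed.

Lemma ext_domain_cone : Dext `<=` ext_cone K.
Proof. by rewrite -interior_ext_cone; exact: interior_subset. Qed.

Let FB : barrier_on Dext (ext_barrier F) (nu + 1) :=
  ext_barrier_on (log_hom_barrier_on hF).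

Lemma corrector_system_unique z :
  pdmx (hess (ext_barrier F) (xbar z)) -> 0 < mu nu z ->
  exists d, forall d', corrector_system F nu A b c z d' <-> d' = d.
Proof.
move=> Hpd mu0; set H := hess _ _ in Hpd *.
have Nu := corrector_mx_unit b c Hpd mu0 hA.
set N := corrector_mx _ _ _ _ _ in Nu.
pose w := invmx N *m col_mx 0 (- psiz F nu z).
exists (dsubmx w, usubmx w, - psiz F nu z - mu nu z *: (H *m dsubmx w)).
move=> [[x y] s]; rewrite /corrector_system /= -/H; split=> [[e1 e2]|[-> -> ->]].
  have sE : s = - psiz F nu z - mu nu z *: (H *m x) by rewrite -e2 addrK.
  have wE : w = col_mx y x.
    rewrite /w; apply: (can_inj (mulKmx Nu)); rewrite mulKVmx//.
    rewrite corrector_mx_mul; move/eqP: e1; rewrite subr_eq0 => /eqP ->.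
    by rewrite add_col_mx addr0 e2.
  by rewrite wE col_mxKu col_mxKd sE.
split; last by rewrite subrK.
have E : Gmx A b c *m col_mx (usubmx w) (dsubmx w) +
    col_mx 0 (mu nu z *: (H *m dsubmx w)) = col_mx 0 (- psiz F nu z).
  by rewrite -corrector_mx_mul vsubmxK mulKVmx.
apply/eqP; rewrite subr_eq0; apply/eqP.
apply: (addIr (col_mx 0 (mu nu z *: (H *m dsubmx w)))).
by rewrite E add_col_mx addr0 subrK.
Qed.

Lemma corrector_step_calN z beta theta : contracts beta theta ->
  calN K F nu beta z ->
  exists z', (forall y, corrector_step F nu A b c 1 z y <-> y = z') /\
             calN K F nu theta z'.
Proof.
move=> bt [/interior_calF[Kx Ks] psile].
have Dx : Dext (xbar z) by rewrite -interior_ext_cone.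
have /= [sK s0] : ext_domain (dual_cone K)° (sbar z) by rewrite -interior_ext_cone.
have [x0 h0] := Dx.
have gap0 : 0 < inner (xbar z) (sbar z).
  rewrite inner_split addrC ltr_pwDl ?mulr_gt0//.
  by apply: (interior_subset sK); exact: interior_subset x0.
have nu0 : 0 <= nu by rewrite -(sqr_lnorm_self (log_hom_barrier_on hF) x0) sqr_ge0.
have nu1 : 0 < nu + 1 by rewrite ltr_wpDl.
have mu0 : 0 < mu nu z by rewrite divr_gt0.
have xs : inner (xbar z) (sbar z) = mu nu z * (nu + 1) by rewrite divfK ?gt_eqF.
have [d dP] := corrector_system_unique (barrier_pd FB Dx) mu0.
have [sys1 sys2] := (dP d).2 erefl.
exists (z + d); split.
  move=> y; split=> [[d' [/dP -> ->]]|->]; first by rewrite scale1r.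
  by exists d; rewrite scale1r; split=> //; exact/dP.
have ortho : inner (xbar d) (sbar d) = 0.
  have := inner_skew (col_mx (ypart d) (xbar d)) (Gmx_skew A b c).
  move/eqP: sys1; rewrite subr_eq0 => /eqP ->.
  by rewrite inner_col_mx inner0r add0r.
have [/andP[b0 b1] /andP[t0 t1] _] := bt.
have db := corrector_length_le FB Dx mu0 sys2 ortho psile.
have resid := corrector_residual_le FB Dx mu0 nu1 xs sys2 ortho (le_lt_trans db b1).
have gap := corrector_gap FB Dx xs sys2 ortho.
have psidx := inner_corrector_residual FB Dx sys2 ortho.
have d0 : 0 <= lnorm (ext_barrier F) (xbar z) (xbar d) by exact: enorm_ge0.
(* The second case is that of a cone in dimension zero. *)
have step_or_dim : 2 <= nu + 1 \/ lnorm (ext_barrier F) (xbar z) (xbar d) = 0.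
  have [nz|nz] := eqVneq n 0%N; last first.
    have D0 : ~ K° 0.
      have [_ _ _ pointed _] := hK.
      by move=> /(pointed_interior pointed)/eqP; rewrite (negbTE nz).
    have := barrier_param_ge1 (log_hom_barrier_on hF) x0 D0; left; lra.
  right; apply/eqP; move: psidx; rewrite (_ : sbar z + _ = 0).
    rewrite inner0r => /esym/eqP; rewrite oppr_eq0 mulf_eq0 gt_eqF//=.
    by rewrite sqrf_eq0.
  apply: (col1_orthogonal nz (lt0r_neq0 h0)).
  by rewrite innerDr innerZr xs [inner _ (grad _ _)]innerC (inner_grad FB Dx) mulrN subrr.
have Dx' : Dext (xbar z + xbar d).
  apply: (barrier_ball FB Dx); rewrite /lball/= addrC addKr.
  exact: le_lt_trans db b1.
have mu'E : mu nu (z + d) = mu nu z *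
    (1 - lnorm (ext_barrier F) (xbar z) (xbar d) ^+ 2 / (nu + 1)).
  have -> : mu nu (z + d) = inner (xbar z + xbar d) (sbar z + sbar d) / (nu + 1) by [].
  by rewrite gap; field; rewrite gt_eqF.
have psi'le : lnormD (ext_barrier F) (xbar (z + d)) (psiz F nu (z + d)) <=
    theta * mu nu (z + d).
  apply: le_trans resid _; rewrite mu'E mulrCA ler_pM2l//.
  case: step_or_dim => [nu2|->].
    by apply: contracts_bound bt _ nu2; rewrite d0 db.
  by rewrite expr0n/= !mul0r addr0 subr0 mulr1.
have mu'0 : 0 < mu nu (z + d).
  rewrite mu'E mulr_gt0// subr_gt0 ltr_pdivrMr// mul1r.
  have : lnorm (ext_barrier F) (xbar z) (xbar d) ^+ 2 < 1.
    by rewrite expr_lt1// (le_lt_trans db).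
  by move=> /lt_le_trans; apply; rewrite lerDr.
split=> //; apply/interior_calF; split.
  by rewrite interior_ext_cone.
have K0 : K 0.
  have [KZ _ _ _ _] := hK; rewrite -(scale0r (usubmx (xbar z))).
  by apply: KZ => //; exact: interior_subset x0.
apply: (interiorS (dual_ext_cone K0)).
apply: (dual_cone_interior FB ext_coneZ ext_domainZ ext_domainD ext_domain_cone Dx').
apply: le_lt_trans psi'le _.
by rewrite gtr_pMl.
Qed.

Lemma corrector_phase_calN (epsilon beta : R) (r : nat) z :
  (forall k, (k < r)%N -> contracts (beta * epsilon ^+ k) (beta * epsilon ^+ k.+1)) ->
  calN K F nu beta z ->
  exists z', (forall y, corrector_phase F nu A b c 1 r z y <-> y = z') /\
             calN K F nu (beta * epsilon ^+ r) z'.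
Proof.
elim: r beta z => [|r IH] beta z contr zN.
  by exists z; split=> //; rewrite expr0 mulr1.
have := contr 0%N isT; rewrite expr0 mulr1 expr1 => contr0.
have [z1 [z1P z1N]] := corrector_step_calN contr0 zN.
have [|z' [z'P z'N]] := IH (beta * epsilon) z1 _ z1N.
  by move=> k kr; rewrite -!mulrA -!exprS; exact: contr.
exists z'; split; last by rewrite exprS mulrA.
move=> y; split=> [[z2 [/z1P -> /z'P]]//|->].
by exists z1; split; [exact/z1P|exact/z'P].
Qed.

End Corrector.

Theorem lemma10 (R : realType) (n m : nat)
  (K : set 'cV[R]_n) (F : 'cV[R]_n -> R) (nu : R)
  (A : 'M[R]_(m, n)) (b : 'cV[R]_m) (c : 'cV[R]_n)
  (hK : proper_cone K) (hF : log_hom_barrier K F nu) (hA : row_free A)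
  (eta beta epsilon alpha_c : R) (r_c : nat) (hr : (0 < r_c)%N)
  (hpar :
     [/\ beta = 20 / 100, epsilon = 50 / 100, r_c = 1%N,
         eta = beta * epsilon ^+ r_c & alpha_c = 1] \/
     [/\ beta = 25 / 100, epsilon = 70 / 100, r_c = 2%N,
         eta = beta * epsilon ^+ r_c & alpha_c = 1])
  (z : pd_point R n m) (hz : calN K F nu beta z) :
  (exists! zp, corrector_phase F nu A b c alpha_c r_c z zp) /\
  (forall zp, corrector_phase F nu A b c alpha_c r_c z zp ->
     calN K F nu eta zp).
Proof.
suff [z' [z'P z'N]] : exists z',
    (forall y, corrector_phase F nu A b c alpha_c r_c z y <-> y = z') /\
    calN K F nu eta z'.
  split; last by move=> y /z'P ->.
  by exists z'; split; [exact/z'P|move=> y /z'P].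
have -> : alpha_c = 1 by case: hpar => -[].
have -> : eta = beta * epsilon ^+ r_c by case: hpar => -[].
apply: corrector_phase_calN => //.
case: hpar => -[-> -> -> _ _] k.
  by case: k => // _; apply: contractsI; lra.
by case: k => [|[|//]] _; apply: contractsI; lra.
Qed.
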